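(* Let $q=p^r\equiv 5 \pmod{8}$ for a prime $p$. Let $\varphi, \chi_4$ be multiplicative characters of $\mathbb{F}_q^*$ of order $2$ and $4$ respectively, and let $\varepsilon$ be the trivial character. Write $q=x^2+y^2$ for integers $x$ and $y$, such that $x \equiv 1 \pmod{4}$, and $p \nmid x$. Then $$\mathcal{K}_4(G_4(q)) = \frac{q(q-1)}{2^{12}} \Biggl[ q^2+2q(5x-21) +24x^2-150x+241 +10 \, q^2 \, {_{3}F_2}\left( \begin{array}{ccc} \chi_4, & \varphi, & \varphi \\ & \varepsilon, & \varepsilon \end{array} \Big| \; 1 \right)_{q} \Biggr].$$
   Context: $\mathbb{F}_q$ is the finite field with $q$ elements. $G_4(q)$ is the digraph with vertex set $\mathbb{F}_q$ where $a \to b$ is an edge if and only if $b-a$ is a nonzero fourth power in $\mathbb{F}_q$ (since $q\equiv 5 \pmod 8$, $-1$ is not a fourth power). For a digraph $G$, $\mathcal{K}_m(G)$ is the number of transitive subtournaments of order $m$ contained in $G$; a tournament of order $m$ is transitive if its vertices can be listed $a_1,\dots,a_m$ with $a_i \to a_j$ for all $i<j$. Every multiplicative character $\chi$ of $\mathbb{F}_q^*$ (complex-valued), including the trivial character $\varepsilon$, is extended to $\mathbb{F}_q$ by $\chi(0):=0$; $\bar{\chi}$ is the inverse of $\chi$. For characters $A,B$ define the Jacobi sum $J(A,B):=\sum_{a \in \mathbb{F}_q} A(a)B(1-a)$ and $\binom{A}{B} := \frac{B(-1)}{q} J(A,\bar{B})$. For characters $A_0,A_1,A_2,B_1,B_2$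 of $\mathbb{F}_q^*$ and $\lambda\in\mathbb{F}_q$, Greene's finite field hypergeometric function is $${_{3}F_2}\left( \begin{array}{ccc} A_0, & A_1, & A_2 \\ & B_1, & B_2 \end{array} \Big| \; \lambda \right)_{q} := \frac{q}{q-1} \sum_{\chi} \binom{A_0 \chi}{\chi} \binom{A_1 \chi}{B_1 \chi} \binom{A_2 \chi}{B_2 \chi} \chi(\lambda),$$ the sum being over all multiplicative characters $\chi$ of $\mathbb{F}_q^*$. *)

(* Defs.v *)
From HB Require Import structures.
From mathcomp Require Import all_boot all_order all_algebra all_fingroup.
From mathcomp Require Import all_solvable all_field all_character.
Set Implicit Arguments.
Unset Strict Implicit.
Unset Printing Implicit Defensive.
Import Order.TTheory GRing.Theory Num.Theory.
Local Open Scope ring_scope.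

Definition fourth_power_digraph (F : finFieldType) : rel F :=
  fun a b => (b - a != 0) && [exists c : F, b - a == c ^+ 4].

(* A subdigraph is a pair H of a vertex set H.1 and an arc set H.2. *)
Definition subdigraph (T : finType) (e : rel T) (H : {set T} * {set T * T}) :=
  (H.2 \subset setX H.1 H.1) && [forall u in H.2, e u.1 u.2].

Definition tournament (T : finType) (H : {set T} * {set T * T}) :=
  [forall a in H.1, forall b in H.1,
     if a == b then (a, b) \notin H.2
     else ((a, b) \in H.2) (+) ((b, a) \in H.2)].

Definition transitive_listing (T : finType) (m : nat)
    (H : {set T} * {set T * T}) :=
  [exists t : m.-tuple T,
     [&& uniq t, [set a in t] == H.1
       & [forall i : 'I_m, forall j : 'I_m,
            (i < j)%N ==> ((tnth t i, tnth t j) \in H.2)]]].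

Definition num_transitive_subtournaments (m : nat) (T : finType) (e : rel T)
    : nat :=
  #|[set H : {set T} * {set T * T} |
      [&& #|H.1| == m, subdigraph e H, tournament H
        & transitive_listing m H]]|.

Section Characters.
Variable F : finFieldType.
Local Notation U := [set: {unit F}]%G.
Implicit Types A B : 'CF(U).

(* A multiplicative character of F is a linear character of the group of units
   of F. Its values are roots of unity, so algC suffices for complex values. *)
Definition chval A (a : F) : algC :=
  if insub a is Some u then A u else 0.

Definition jacobi_sum A B : algC := \sum_(a : F) chval A a * chval B (1 - a).

Definition char_binom A B : algC :=
  chval B (- 1) / #|F|%:R * jacobi_sum A B^-1.

Definition greene_3F2 A0 A1 A2 B1 B2 (lambda : F) : algC :=
  #|F|%:R / (#|F|%:R - 1) *
  \sum_(i : Iirr U | 'chi_i \is a linear_char)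
     char_binom (A0 * 'chi_i) 'chi_i * char_binom (A1 * 'chi_i) (B1 * 'chi_i)
     * char_binom (A2 * 'chi_i) (B2 * 'chi_i) * chval 'chi_i lambda.

End Characters.

(* Main.v *)
Require Import Defs.
From mathcomp Require Import all_boot all_order all_algebra all_fingroup.
From mathcomp Require Import all_solvable all_field all_character.
From mathcomp Require Import ring zify.
Set Implicit Arguments.
Unset Strict Implicit.
Unset Printing Implicit Defensive.
Import Order.TTheory GRing.Theory Num.Theory.
Local Open Scope ring_scope.

(** A transitive subtournament has exactly one transitive listing, so the
    number of those of order 4 is the number of 4-tuples in which every
    later entry minus an earlier one is a nonzero fourth power. An affine
    change of variable brings the first and last entries to 0 and 1: the
    number is [q (q - 1) / 4] times the number [N] of pairs [c], [d] for
    which [c], [1 - c], [d], [1 - d] and [d - c] are nonzero fourth powers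
    ([num_transitive_subtournaments4]).

    Let [chi] be the character of order 4. The indicator of the fourth
    powers is the mean of the four powers of [chi], so [4 ^ 5 N] is the sum
    over 1024 labels [(i, j, k, m, n)] of the sums of [chi ^ i c * chi ^ j
    (1 - c) * chi ^ k d * chi ^ m (1 - d) * chi ^ n (d - c)] over [c] and
    [d]. These are sums over the configurations of five points [oo, 0, 1, d,
    c] of the projective line, each pair of points carrying a power of
    [chi]; permuting the five points permutes the labels, up to signs that
    come from [chi (-1) = -1] ([conf_sum_orbit]). If one of the ten pairs
    carries the trivial character, a permutation moves it to [c d] and the
    sum is a combination of Jacobi sums ([conf_sum_split]). All Jacobi sums
    of powers of [chi] are known in terms of [q] and the Jacobi sum [J] of
    [chi] and [chi ^ 2] ([jac_formP]). Of the other labels, some have a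
    permutation that changes the sign of the sum, or turns the sum into
    minus its conjugate, and contribute no real part. There remain the label
    with all entries 2, whose sum is [J ^ 2] plus its conjugate
    ([conf_sum_quadratic]), and the images of [(1, 2, 2, 2, 3)], whose sums
    are, up to sign, [q ^ 2] times the hypergeometric value, by
    orthogonality of characters ([greene_3F2_conf_sum]). Adding up the 1024
    contributions is a computation ([count_fourth_pairs]).

    Finally [x] is the real part of [J]. Indeed [J] has absolute value the
    square root of [q], its real part is 1 modulo 4, and it is prime to [p],
    because the images of [J] under the two reductions of the Gaussian
    integers to [F] are 0 and, up to sign, a nonzero binomial coefficient
    ([gaussian_jac]); and [q] has only one representation as a sum of two
    squares with these properties ([prime_power_sum2_unique]). *)

(** * Quartic characters and their Jacobi sums *)

(** A character of order 4 of the multiplicative group of [F], extended by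
    0, with value -1 at -1 (so that [#|F|] is 5 modulo 8); [g] is a
    generator of the multiplicative group. *)
Record odd_quartic_character (F : finFieldType) (chi : F -> algC) (g : F) :
    Prop := OddQuarticCharacter {
  oqc_zero : chi 0 = 0;
  oqc_mul : forall a b, chi (a * b) = chi a * chi b;
  oqc_opp1 : chi (- 1) = - 1;
  oqc_gen : forall a, a != 0 -> exists k, a = g ^+ k;
  oqc_sqr_gen : chi g ^+ 2 = - 1
}.

Section QuarticCharacter.
Variables (F : finFieldType) (chi : F -> algC) (g : F).
Hypothesis chiP : odd_quartic_character chi g.

Local Notation q := (#|F|%:R : algC).

(** The power [chi ^ k], extended by 0 also when it is trivial. *)
Definition chipow (k : nat) (a : F) : algC := (a != 0)%:R * chi a ^+ k.
Local Notation X := chipow.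

Lemma chi1 : chi 1 = 1.
Proof.
have := oqc_mul chiP (-1) (-1); rewrite mulrNN mulr1 (oqc_opp1 chiP).
by rewrite mulrNN mulr1.
Qed.

Lemma chiX a n : chi (a ^+ n) = chi a ^+ n.
Proof.
elim: n => [|n IHn]; first by rewrite !expr0 chi1.
by rewrite !exprS (oqc_mul chiP) IHn.
Qed.

Lemma chi_gen4 : chi g ^+ 4 = 1.
Proof. by rewrite (exprM _ 2 2) (oqc_sqr_gen chiP) sqrrN expr1n. Qed.

Lemma chi_exp4 a : a != 0 -> chi a ^+ 4 = 1.
Proof.
move=> /(oqc_gen chiP)[k ->].
by rewrite chiX -exprM mulnC exprM chi_gen4 expr1n.
Qed.

Lemma chi_neq0 a : a != 0 -> chi a != 0.
Proof.
move=> /chi_exp4 ha; apply/eqP => h0; move: ha; rewrite h0 expr0n /= => /eqP.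
by rewrite eq_sym oner_eq0.
Qed.

Lemma chi_gen_neq0 : chi g != 0.
Proof.
apply/eqP => h; move: chi_gen4; rewrite h expr0n => /eqP.
by rewrite eq_sym oner_eq0.
Qed.

Lemma gen_neq0 : g != 0.
Proof.
by apply/eqP => g0; move: chi_gen_neq0; rewrite g0 (oqc_zero chiP) eqxx.
Qed.

(** The values of [chi] are fourth roots of unity, so conjugation is cubing. *)
Lemma chi_conj a : (chi a)^* = chi a ^+ 3.
Proof.
have [->|a0] := eqVneq a 0; first by rewrite (oqc_zero chiP) rmorph0 expr0n.
have n1 : `|chi a| = 1.
  by apply/eqP; rewrite -(@pexpr_eq1 _ _ 4) // -normrX chi_exp4 ?normr1.
have := normCK (chi a); rewrite n1 expr1n => h.
apply: (mulfI (chi_neq0 a0)).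
by rewrite -h -exprS chi_exp4.
Qed.

Lemma chipow0 k : X k 0 = 0.
Proof. by rewrite /X eqxx mul0r. Qed.

Lemma chipow_neq0 k a : a != 0 -> X k a = chi a ^+ k.
Proof. by rewrite /X => ->; rewrite mul1r. Qed.

Lemma chipow1 k : X k 1 = 1.
Proof. by rewrite chipow_neq0 ?oner_eq0 // chi1 expr1n. Qed.

Lemma chipowM k a b : X k (a * b) = X k a * X k b.
Proof.
by rewrite /X mulf_eq0 negb_or (oqc_mul chiP) exprMn -mulnb natrM; ring.
Qed.

Lemma chipowD j k a : X (j + k) a = X j a * X k a.
Proof. by rewrite /X exprD; case: (a != 0); rewrite ?mul0r ?mul1r. Qed.

Lemma chipow_mod4 k a : X (k %% 4) a = X k a.
Proof.
have [->|a0] := eqVneq a 0; first by rewrite !chipow0.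
rewrite !chipow_neq0 // [in RHS](divn_eq k 4) exprD mulnC exprM chi_exp4 //.
by rewrite expr1n mul1r.
Qed.

Lemma eq_chipow j k a : j = k %[mod 4] -> X j a = X k a.
Proof. by move=> h; rewrite -chipow_mod4 h chipow_mod4. Qed.

Lemma chipowV k a : X k a^-1 = X (3 * k) a.
Proof.
have [->|a0] := eqVneq a 0; first by rewrite invr0 !chipow0.
apply: (mulfI (x := X k a)); first by rewrite chipow_neq0 ?expf_neq0 ?chi_neq0.
rewrite -chipowM divff // chipow1 -chipowD -chipow_mod4.
by rewrite -mulSn modnMr chipow_neq0.
Qed.

Lemma chipow_conj k a : (X k a)^* = X (3 * k) a.
Proof. by rewrite /X rmorphM /= rmorphXn /= rmorph_nat chi_conj exprM. Qed.

Lemma chipowN1 k : X k (- 1) = (- 1) ^+ k.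
Proof. by rewrite chipow_neq0 ?oppr_eq0 ?oner_eq0 // (oqc_opp1 chiP). Qed.

Lemma chipowN k a : X k (- a) = (- 1) ^+ k * X k a.
Proof. by rewrite -[in LHS](mulN1r a) chipowM chipowN1. Qed.

Lemma chipow_sqr k a : X k (a ^+ 2) = X (2 * k) a.
Proof. by rewrite expr2 chipowM -chipowD mul2n addnn. Qed.

(** Odd powers of [chi] differ from 1 at [-1], and [chi ^ 2] at [g]. *)
Lemma chipow_nontrivial k : (k %% 4 != 0)%N -> exists2 b, b != 0 & X k b != 1.
Proof.
have m1 : -1 != 1 :> algC.
  by rewrite -subr_eq0 -opprD oppr_eq0 -(natrD _ 1 1) pnatr_eq0.
move=> k0; have [k2|k2] := eqVneq (k %% 4)%N 2%N.
  exists g; first exact: gen_neq0.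
  by rewrite -chipow_mod4 k2 chipow_neq0 ?gen_neq0 // (oqc_sqr_gen chiP).
exists (-1); first by rewrite oppr_eq0 oner_eq0.
rewrite chipowN1 -signr_odd.
have -> : odd k by lia.
by rewrite expr1.
Qed.

Lemma sum_neq0_indicator : \sum_(a : F) (a != 0)%:R = q - 1 :> algC.
Proof.
have F1 : (0 < #|F|)%N by apply/card_gt0P; exists 0.
rewrite -natr_sum -big_mkcond sum1_card.
by rewrite (cardC1 (0 : F)) -subn1 natrB.
Qed.

Lemma sum_chipow k : \sum_a X k a = if (k %% 4 == 0)%N then q - 1 else 0.
Proof.
have [k0|/chipow_nontrivial[b b0 bn1]] := eqVneq (k %% 4)%N 0%N.
  rewrite -sum_neq0_indicator; apply: eq_bigr => a _.
  by rewrite -chipow_mod4 k0 /X expr0 mulr1.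
have h : X k b * (\sum_a X k a) = \sum_a X k a.
  rewrite mulr_sumr [RHS](reindex (fun a => b * a)) /=; last first.
    by exists (fun a => b^-1 * a) => a _; rewrite ?mulKf ?mulVKf.
  by apply: eq_bigr => a _; rewrite chipowM.
move/eqP: h; rewrite -subr_eq0 -[X in _ - X]mul1r -mulrBl mulf_eq0 subr_eq0.
by rewrite (negPf bn1) => /eqP.
Qed.

Lemma algC_N1_neq1 : -1 != 1 :> algC.
Proof. by rewrite -subr_eq0 -opprD oppr_eq0 -(natrD _ 1 1) pnatr_eq0. Qed.

Lemma two_neq0 : 2 != 0 :> F.
Proof.
apply/eqP => h2; have := oqc_opp1 chiP.
have -> : -1 = 1 :> F by apply/eqP; rewrite eq_sym -addr_eq0 -mulr2n h2.
by rewrite chi1 => /eqP; rewrite eq_sym (negPf algC_N1_neq1).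
Qed.

Lemma four_neq0 : 4 != 0 :> F.
Proof. by rewrite (natrM _ 2 2) mulf_neq0 ?two_neq0. Qed.

Lemma chipow2_eq1 a : X 2 a = 1 -> exists2 c, c != 0 & a = c ^+ 2.
Proof.
have [->|a0] := eqVneq a 0.
  by rewrite chipow0 => /eqP; rewrite eq_sym oner_eq0.
have [k ak] := oqc_gen chiP a0.
rewrite chipow_neq0 // ak chiX -exprM mulnC exprM.
rewrite (oqc_sqr_gen chiP) -signr_odd; case: (boolP (odd k)) => [_ /eqP|ke _].
  by rewrite expr1 (negPf algC_N1_neq1).
exists (g ^+ k./2); first by rewrite expf_neq0 ?gen_neq0.
by rewrite -exprM muln2 even_halfK.
Qed.

Lemma chipow2_values a : a != 0 -> X 2 a = 1 \/ X 2 a = -1.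
Proof.
move=> a0; apply/pred2P; rewrite -eqf_sqr expr1n chipow_neq0 // -exprM.
by rewrite chi_exp4.
Qed.

(** The quadratic character [chi ^ 2] counts square roots. *)
Lemma card_sqrt a : #|[pred m : F | m ^+ 2 == a]|%:R = 1 + X 2 a.
Proof.
have [->|a0] := eqVneq a 0.
  rewrite chipow0 addr0 (@eq_card1 _ 0) // => m.
  by rewrite !inE sqrf_eq0.
have [h|h] := chipow2_values a0; rewrite h.
  have [c c0 ->] := chipow2_eq1 h.
  rewrite (@eq_card _ _ (pred2 c (- c))) => [|m]; last by rewrite !inE eqf_sqr.
  have cN : c != - c.
    by rewrite -addr_eq0 -mulr2n -(mulr_natl c) mulf_neq0 ?two_neq0.
  by rewrite card2 cN -natr1.
rewrite subrr eq_card0 // => m; rewrite !inE; apply/eqP => hm.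
have m0 : m != 0 by apply: contraNneq a0 => m0; rewrite -hm m0 expr0n.
move: h; rewrite -hm chipow_sqr chipow_neq0 // chi_exp4 // => /eqP.
by rewrite eq_sym (negPf algC_N1_neq1).
Qed.

Lemma sum_sqr (f : F -> algC) :
  \sum_m f (m ^+ 2) = \sum_a (1 + X 2 a) * f a.
Proof.
rewrite (partition_big (fun m => m ^+ 2) predT) //=; apply: eq_bigr => a _.
rewrite (eq_bigr (fun=> f a)) => [|m /eqP-> //].
by rewrite sumr_const -card_sqrt mulr_natl.
Qed.

(** [jac j k] is the Jacobi sum of [chi ^ j] and [chi ^ k]. *)
Definition jac (j k : nat) : algC := \sum_a X j a * X k (1 - a).

Lemma sum_rev (V : zmodType) (f : F -> V) : \sum_a f (1 - a) = \sum_a f a.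
Proof.
rewrite [RHS](reindex (fun a => 1 - a)) //=.
by exists (fun a => 1 - a) => a _; rewrite opprB addrC subrK.
Qed.

Lemma sum_scale (V : zmodType) (f : F -> V) b :
  b != 0 -> \sum_a f (b * a) = \sum_a f a.
Proof.
move=> b0; rewrite [RHS](reindex (fun a => b * a)) //=.
by exists (fun a => b^-1 * a) => a _; rewrite ?mulKf ?mulVKf.
Qed.

Lemma sum_shift (V : zmodType) (f : F -> V) b : \sum_a f (a + b) = \sum_a f a.
Proof.
rewrite [RHS](reindex (fun a => a + b)) //=.
by exists (fun a => a - b) => a _; rewrite ?addrK ?subrK.
Qed.

Lemma jacC j k : jac j k = jac k j.
Proof.
rewrite /jac -[LHS]sum_rev; apply: eq_bigr => a _.
by rewrite mulrC opprB addrC subrK.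
Qed.

Lemma eq_jac j j' k k' :
  j = j' %[mod 4] -> k = k' %[mod 4] -> jac j k = jac j' k'.
Proof.
move=> hj hk; apply: eq_bigr => a _.
by rewrite (eq_chipow _ hj) (eq_chipow _ hk).
Qed.

Lemma jac_conj j k : (jac j k)^* = jac (3 * j) (3 * k).
Proof.
by rewrite rmorph_sum; apply: eq_bigr => a _; rewrite rmorphM /= !chipow_conj.
Qed.

Lemma jac0 k : jac 0 k = (if (k %% 4 == 0)%N then q - 1 else 0) - 1.
Proof.
rewrite -sum_chipow -(sum_rev (X k)) (bigD1 (0 : F)) //= subr0 chipow1.
rewrite [1 + _]addrC addrK /jac (bigD1 (0 : F)) //= chipow0 mul0r add0r.
by apply: eq_bigr => a a0; rewrite /X a0 expr0 !mul1r.
Qed.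

(** The substitution [u = a / (1 - a)] reaches every [u] except -1. *)
Lemma jac_inv j : (j %% 4 != 0)%N -> jac j (3 * j) = - (- 1) ^+ j.
Proof.
move=> j0; rewrite -chipowN1; apply/eqP; rewrite -addr_eq0; apply/eqP.
transitivity (\sum_a X j a); last by rewrite sum_chipow (negPf j0).
rewrite [RHS](bigD1 (-1)) //= addrC; congr (_ + _).
rewrite /jac (bigD1 (1 : F)) //= subrr chipow0 mulr0 add0r.
rewrite [RHS](reindex_onto (fun a => a / (1 - a)) (fun u => u / (1 + u))) /=.
  apply: eq_big => [a|a _]; last by rewrite -chipowV -chipowM.
    have [->|a1] := eqVneq a 1.
      by rewrite subrr invr0 mulr0 mul0r [_ == 1]eq_sym oner_eq0 andbF.
    have h : 1 - a != 0 by rewrite subr_eq0 eq_sym.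
    have e : 1 + a / (1 - a) = (1 - a)^-1 by field.
    rewrite -addr_eq0 addrC e invr_eq0 h /=.
    by rewrite invrK divfK ?eqxx.
  move=> i; rewrite -addr_eq0 addrC => h; field.
  by rewrite h addrK oner_eq0.
Qed.

(** If [c ^ 2 = -1] then [(1 + c) ^ 2 = 2 c], and [chi ^ 2] is -1 at [c]. *)
Lemma chipow2_two : X 2 2 = -1.
Proof.
have [|c c0 cE] := @chipow2_eq1 (-1); first by rewrite chipowN1 sqrrN expr1n.
have hc : X 2 c = -1.
  by rewrite chipow_neq0 // -chiX -cE (oqc_opp1 chiP).
have c1 : 1 + c != 0.
  apply/eqP => /eqP; rewrite addrC addr_eq0 => /eqP h.
  have := oqc_opp1 chiP; rewrite cE h sqrrN expr1n chi1 => /eqP.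
  by rewrite eq_sym (negPf algC_N1_neq1).
have e : (1 + c) ^+ 2 = 2 * c by rewrite sqrrD -cE; ring.
have : X 2 ((1 + c) ^+ 2) = 1 by rewrite chipow_sqr chipow_neq0 ?chi_exp4.
by rewrite e chipowM hc mulrN1 => /eqP; rewrite eqr_oppLR => /eqP.
Qed.

(** Completing the square, [a (1 - a) = (1 - (2 a - 1) ^ 2) / 4]; the value of
    [chi ^ k] at 4 is that of [chi ^ 2] at 2, which is -1. *)
Lemma jac_diag k : odd k -> jac k k = - jac k 2.
Proof.
move=> ko.
have k4 : X k 4^-1 = -1.
  rewrite -[4]/(2 * 2)%:R natrM -expr2 chipowV chipow_sqr -chipow2_two.
  by apply: eq_chipow; lia.
transitivity (\sum_a X k 4^-1 * X k (1 - (2 * (a - 2^-1)) ^+ 2)).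
  apply: eq_bigr => a _; rewrite -!chipowM; congr X.
  by field; rewrite ?two_neq0 ?four_neq0.
rewrite -mulr_sumr (sum_shift (fun a => X k (1 - (2 * a) ^+ 2))).
rewrite (sum_scale (fun a => X k (1 - a ^+ 2))) ?two_neq0 //.
rewrite (sum_sqr (fun a => X k (1 - a))) k4 mulN1r jacC; congr (- _).
under eq_bigr do rewrite mulrDl mul1r.
rewrite big_split /= sum_rev sum_chipow (_ : (k %% 4 == 0)%N = false) ?add0r //.
by lia.
Qed.

Lemma jac22 : jac 2 2 = -1.
Proof. by rewrite (@eq_jac 2 2 2 (3 * 2)) // jac_inv // sqrrN expr1n. Qed.

Lemma sum_chipow2_quad (t : F) : t != 0 ->
  \sum_b X 2 (1 - b * t) * X 2 (1 - b) = if t == 1 then q - 1 else - X 2 t.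
Proof.
move=> t0; have [->|t1] := eqVneq t 1.
  rewrite -[RHS](sum_chipow 4) -[RHS]sum_rev.
  by apply: eq_bigr => b _; rewrite mulr1 -chipowD.
have e0 : t^-1 - 1 != 0 by rewrite subr_eq0 invr_eq1.
rewrite -[X 2 t]mulr1 -mulrN -jac22 -sum_rev /jac mulr_sumr.
rewrite -[LHS](@sum_scale _ _ (1 - t^-1)); last by rewrite -opprB oppr_eq0.
apply: eq_bigr => u _; rewrite -!chipowM.
have -> : (1 - (1 - (1 - t^-1) * u) * t) * (1 - (1 - (1 - t^-1) * u))
   = - (t * (u * (1 - u))) * (t^-1 - 1) ^+ 2 by field.
rewrite [LHS]chipowM chipow_sqr (chipow_neq0 _ e0) chi_exp4 // mulr1.
by rewrite chipowN sqrrN expr1n mul1r.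
Qed.

Lemma jac_norm : jac 1 2 * jac 3 2 = q.
Proof.
have h1 : \sum_t X 1 t = 0 by rewrite sum_chipow.
transitivity (\sum_b \sum_t
   X 1 t * (X 2 (1 - b * t) * X 2 (1 - b) - (b == 0)%:R)).
  rewrite mulrC /jac mulr_suml; apply: eq_bigr => b _; rewrite mulr_sumr.
  have [->|b0] := eqVneq b 0.
    rewrite big1 => [|a _]; last by rewrite chipow0 !mul0r.
    rewrite big1 // => t _.
    by rewrite mul0r !subr0 !chipow1 mulr1 subrr mulr0.
  rewrite -(sum_scale _ b0); apply: eq_bigr => t _.
  rewrite subr0 chipowM.
  transitivity (X 3 b * X 1 b * X 1 t * (X 2 (1 - b * t) * X 2 (1 - b))).
    by ring.
  by rewrite -chipowD (chipow_neq0 _ b0) chi_exp4 // mul1r.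
rewrite exchange_big /=.
transitivity (\sum_t (X 1 t * (if t == 1 then q - 1 else - X 2 t) - X 1 t)).
  apply: eq_bigr => t _; have [->|t0] := eqVneq t 0.
    by rewrite chipow0 !mul0r subr0 big1 // => b _; rewrite mul0r.
  rewrite -mulr_sumr sumrB sum_chipow2_quad // mulrBr; congr (_ - _).
  by rewrite (bigD1 0) //= eqxx big1 ?addr0 ?mulr1 // => b /negPf->.
rewrite sumrB h1 subr0 (bigD1 (1 : F)) //= eqxx chipow1 mul1r.
rewrite (eq_bigr (fun t => - X 3 t)) => [|t /negPf->]; last first.
  by rewrite mulrN -chipowD.
have := sum_chipow 3; rewrite (bigD1 (1 : F)) //= chipow1 sumrN.
by move=> /(canRL (addKr 1))->; rewrite addr0 opprK subrK.
Qed.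
End QuarticCharacter.

(** * A two-dimensional character sum *)

Section ConfigurationSums.
Variables (F : finFieldType) (chi : F -> algC) (g : F).
Hypothesis chiP : odd_quartic_character chi g.

Local Notation q := (#|F|%:R : algC).
Local Notation X := (chipow chi).
Local Notation jac := (jac chi).

Let two0 : 2 != 0 :> F := two_neq0 chiP.

Lemma chipow2_sqrM b a : b != 0 -> X 2 (b ^+ 2 * a) = X 2 a.
Proof.
move=> b0; rewrite (chipowM chiP) (chipow_sqr chiP) chipow_neq0 //.
by rewrite (chi_exp4 chiP) ?mul1r.
Qed.

(** The map [s |-> s + e / s] takes the value [r] as often as
    [r ^ 2 - 4 e] has square roots. *)
Lemma sum_add_inv (e : F) (f : F -> algC) : e != 0 ->
  \sum_(s | s != 0) f (s + e / s) = \sum_r (1 + X 2 (r ^+ 2 - 4 * e)) * f r.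
Proof.
move=> e0; rewrite (partition_big (fun s => s + e / s) predT) //=.
apply: eq_bigr => r _; rewrite (eq_bigr (fun=> f r)) => [|s /andP[_ /eqP->] //].
rewrite sumr_const -(card_sqrt chiP) mulr_natl; congr (_ *+ _).
rewrite -[LHS]sum1_card -[RHS]sum1_card.
rewrite (reindex (fun m => 2^-1 * (m + r))) /=; last first.
  by exists (fun s => 2 * s - r) => s _; field.
apply: eq_bigl => m; rewrite !unfold_in /=.
have [m0|m0] := eqVneq (m + r) 0.
  rewrite m0 mulr0 eqxx /=; apply/esym/eqP => h.
  move/eqP: m0; rewrite addr_eq0 => /eqP m0; move: h; rewrite m0 sqrrN => /eqP.
  rewrite -subr_eq0 opprB addrC subrK mulf_eq0 (negPf e0) orbF.
  by rewrite (negPf (four_neq0 chiP)).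
rewrite mulf_neq0 ?invr_neq0 //=.
rewrite -subr_eq0 -[in RHS]subr_eq0.
have -> : 2^-1 * (m + r) + e / (2^-1 * (m + r)) - r
  = (m ^+ 2 - (r ^+ 2 - 4 * e)) / (2 * (m + r)) by field; rewrite m0 two0.
by rewrite mulf_eq0 invr_eq0 mulf_eq0 (negPf two0) (negPf m0) !orbF.
Qed.

Lemma sum_chipow_1Bsqr k : odd k -> \sum_r X k (1 - r ^+ 2) = jac k 2.
Proof.
move=> ko; rewrite (sum_sqr chiP (fun a => X k (1 - a))) jacC.
under eq_bigr do rewrite mulrDl mul1r.
rewrite big_split /= sum_rev (sum_chipow chiP).
by rewrite (_ : (k %% 4 == 0)%N = false) ?add0r //; lia.
Qed.

Lemma sum_chipow2_sqrB1 : \sum_r X 2 (r ^+ 2 - 1) = -1.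
Proof.
transitivity (\sum_r X 2 (1 - r ^+ 2)).
  by apply: eq_bigr => r _; rewrite -opprB (chipowN chiP) sqrrN expr1n mul1r.
rewrite (sum_sqr chiP (fun a => X 2 (1 - a))).
under eq_bigr do rewrite mulrDl mul1r.
rewrite big_split /= sum_rev (sum_chipow chiP) add0r; exact: jac22 chiP.
Qed.

Lemma sum_chipow2_quartic (D : F) : D != 0 ->
  \sum_s X 2 ((s + 1) ^+ 2 - D) * X 2 ((s - 1) ^+ 2 - D)
  = \sum_r X 2 (r ^+ 2 - 1) * X 2 (r ^+ 2 - 1 + D).
Proof.
move=> D0; have [->|D1] := eqVneq D 1.
  rewrite -(sum_scale _ two0); apply: eq_bigr => r _.
  rewrite -!(chipowM chiP) -[RHS](chipow2_sqrM _ (four_neq0 chiP)).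
  by congr X; ring.
have e0 : 1 - D != 0 by rewrite subr_eq0 eq_sym.
transitivity (1 + \sum_(s | s != 0) X 2 ((s + (1 - D) / s) ^+ 2 - 4)).
  rewrite (bigD1 (0 : F)) //=; congr (_ + _).
    rewrite add0r sub0r sqrrN expr1n -(chipowD chi 2 2) chipow_neq0 //.
    exact: (chi_exp4 chiP).
  apply: eq_bigr => s s0; rewrite -(chipowM chiP) -[RHS](chipow2_sqrM _ s0).
  by congr X; field.
rewrite (sum_add_inv (fun r => X 2 (r ^+ 2 - 4)) e0) -(sum_scale _ two0).
transitivity (1 + \sum_r (1 + X 2 (r ^+ 2 - 1 + D)) * X 2 (r ^+ 2 - 1)).
  congr (_ + _); apply: eq_bigr => r _.
  have -> : (2 * r) ^+ 2 - 4 * (1 - D) = 2 ^+ 2 * (r ^+ 2 - 1 + D) by ring.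
  have -> : (2 * r) ^+ 2 - 4 = 2 ^+ 2 * (r ^+ 2 - 1) by ring.
  by rewrite !chipow2_sqrM.
under eq_bigr do rewrite mulrDl mul1r.
rewrite big_split /= sum_chipow2_sqrB1 addNKr.
by apply: eq_bigr => r _; rewrite mulrC.
Qed.

Lemma sum_chipow_quartic k : odd k ->
  \sum_D X k D * \sum_s X 2 ((s + 1) ^+ 2 - D) * X 2 ((s - 1) ^+ 2 - D)
  = jac k 2 ^+ 2.
Proof.
move=> ko.
transitivity (\sum_D \sum_r X k D * (X 2 (r ^+ 2 - 1) * X 2 (r ^+ 2 - 1 + D))).
  apply: eq_bigr => D _; rewrite -mulr_sumr.
  have [->|D0] := eqVneq D 0; first by rewrite chipow0 !mul0r.
  by rewrite sum_chipow2_quartic.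
rewrite exchange_big /= expr2 -{1}(sum_chipow_1Bsqr ko) mulr_suml.
apply: eq_bigr => r _; rewrite -[1 - _]opprB.
set n := r ^+ 2 - 1; have [->|n0] := eqVneq n 0.
  by rewrite big1 ?oppr0 ?chipow0 ?mul0r // => D _; rewrite mul0r mulr0.
rewrite -(sum_scale _ (_ : - n != 0)) ?oppr_eq0 // mulr_sumr.
apply: eq_bigr => u _.
have -> : n + - n * u = n * (1 - u) by ring.
rewrite !(chipowM chiP).
transitivity (X 2 n * X 2 n * (X k (- n) * (X k u * X 2 (1 - u)))).
  by ring.
by rewrite -(chipowD chi 2 2) (chipow_neq0 _ _ n0) (chi_exp4 chiP) ?mul1r.
Qed.

(** Character sums over the configurations of five points [oo, 0, 1, d, c] of
    the projective line: the characters attached to the pairs [0 c], [1 c],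
    [0 d], [1 d] and [c d] are the powers of [chi] listed in [l]. *)
Definition conf_sum (l : nat * nat * nat * nat * nat) : algC :=
  let: (i, j, k, m, n) := l in
  \sum_c \sum_d X i c * X j (1 - c) * X k d * X m (1 - d) * X n (d - c).

(** In terms of [s = 2 c - 1 + (d - c)] and [D = (d - c) ^ 2], whose value
    under [chi] is that of [d - c] under [chi ^ 2], this sum becomes a sum over
    [D] of [chi D] and its conjugate. *)
Lemma conf_sum_quadratic :
  conf_sum (2, 2, 2, 2, 2)%N = jac 1 2 ^+ 2 + jac 3 2 ^+ 2.
Proof.
rewrite -!sum_chipow_quartic // -big_split /=.
set h := fun D : F => \sum_s X 2 ((s + 1) ^+ 2 - D) * X 2 ((s - 1) ^+ 2 - D).
transitivity (\sum_D (1 + X 2 D) * (X 1 D * h D)); last first.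
  apply: eq_bigr => D _; rewrite -/(h D) -mulrDl mulrA; congr (_ * _).
  by rewrite mulrDl mul1r -chipowD.
rewrite -(sum_sqr chiP (fun D => X 1 D * h D)).
transitivity (\sum_c \sum_e
   X 2 c * X 2 (1 - c) * X 2 (c + e) * X 2 (1 - (c + e)) * X 2 e).
  apply: eq_bigr => c _; rewrite -(sum_shift _ c); apply: eq_bigr => e _.
  by rewrite addrK [e + c]addrC.
rewrite exchange_big /=; apply: eq_bigr => e _.
rewrite (chipow_sqr chiP) mulr_sumr.
rewrite -(sum_scale _ (_ : 2^-1 != 0)) ?invr_neq0 //.
rewrite -(sum_shift _ (1 - e)); apply: eq_bigr => s _.
rewrite [RHS]mulrC; congr (_ * _); rewrite -!(chipowM chiP).
rewrite -[LHS](chipow2_sqrM _ (four_neq0 chiP)); congr X.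
by field.
Qed.
End ConfigurationSums.

(** * The symmetric group on the five points *)

(** A configuration sum is described by the five exponents listed in
    [conf_sum], read modulo 4. *)
Definition label : Type := (nat * nat * nat * nat * nat)%type.

(** The effect on a label of the transpositions [(oo 0)], [(0 1)], [(1 d)] and
    [(d c)], with a boolean that is [true] when the sum changes sign. *)
Definition swap (s : nat) (l : label) : bool * label :=
  let: (i, j, k, m, n) := l in
  match s with
  | 0 => (odd (j + m + n),
          ((3 * (i + j + n)) %% 4, j, (3 * (k + m + n)) %% 4, m, n))
  | 1 => (odd n, (j, i, m, k, n))
  | 2 => (odd m, (i, n, (3 * (i + j + k + m + n)) %% 4, m, j))
  | _ => (odd n, (k, m, i, j, n))
  end%N.

Definition swap_word (w : seq nat) (sl : bool * label) : bool * label :=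
  foldl (fun sl s => let: (b, l) := swap s sl.2 in (sl.1 (+) b, l)) sl w.

(** Words in the four transpositions, which are Coxeter generators of the
    symmetric group on five points; every permutation occurs exactly once. *)
Definition sym5_words : seq (seq nat) :=
  foldl (fun ws t => [seq w ++ take k t | w <- ws, k <- iota 0 (size t).+1])
    [:: [::]] [:: [:: 0]; [:: 1; 0]; [:: 2; 1; 0]; [:: 3; 2; 1; 0]]%N.

Definition label_orbit (l : label) : seq (bool * label) :=
  [seq swap_word w (false, l) | w <- sym5_words].

Section SymmetricGroup.
Variables (F : finFieldType) (chi : F -> algC) (g : F).
Hypothesis chiP : odd_quartic_character chi g.

Local Notation q := (#|F|%:R : algC).
Local Notation X := (chipow chi).
Local Notation jac := (jac chi).
Local Notation conf_sum := (conf_sum chi).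

Lemma sum_inv (V : zmodType) (f : F -> V) : \sum_a f a^-1 = \sum_a f a.
Proof.
rewrite [RHS](reindex (fun a => a^-1)) //=.
by exists (fun a => a^-1) => a _; rewrite invrK.
Qed.

Lemma conf_sum_swap_oo0 l :
  conf_sum l = (-1) ^+ (swap 0 l).1 * conf_sum (swap 0 l).2.
Proof.
case: l => [[[[i j] k] m] n] /=; rewrite mulr_sumr -sum_inv.
apply: eq_bigr => c _; rewrite mulr_sumr -sum_inv; apply: eq_bigr => d _.
rewrite !(chipow_mod4 chiP).
have [->|c0] := eqVneq c 0; first by rewrite invr0 !chipow0 !(mul0r, mulr0).
have [->|d0] := eqVneq d 0; first by rewrite invr0 !chipow0 !(mul0r, mulr0).
have -> : 1 - c^-1 = - (1 - c) * c^-1 by field.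
have -> : 1 - d^-1 = - (1 - d) * d^-1 by field.
have -> : d^-1 - c^-1 = - (d - c) * (c^-1 * d^-1) by field; rewrite c0 d0.
rewrite !(chipowM chiP) !(chipowN chiP) !(chipowV chiP) signr_odd.
by rewrite !mulnDr !chipowD !exprD; ring.
Qed.

Lemma conf_sum_swap01 l :
  conf_sum l = (-1) ^+ (swap 1 l).1 * conf_sum (swap 1 l).2.
Proof.
case: l => [[[[i j] k] m] n] /=; rewrite mulr_sumr -sum_rev.
apply: eq_bigr => c _; rewrite mulr_sumr -sum_rev; apply: eq_bigr => d _.
have -> : 1 - d - (1 - c) = - (d - c) by ring.
have revK (a : F) : 1 - (1 - a) = a by ring.
by rewrite !revK (chipowN chiP) signr_odd; ring.
Qed.

Lemma conf_sum_swap1d l :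
  conf_sum l = (-1) ^+ (swap 2 l).1 * conf_sum (swap 2 l).2.
Proof.
case: l => [[[[i j] k] m] n] /=; rewrite exchange_big [in RHS]exchange_big /=.
rewrite mulr_sumr -[LHS]sum_inv; apply: eq_bigr => v _.
rewrite !(chipow_mod4 chiP); have [->|v0] := eqVneq v 0.
  by rewrite !big1 ?mulr0 // => u _; rewrite ?invr0 !chipow0 !(mul0r, mulr0).
rewrite mulr_sumr -(sum_scale _ (_ : v^-1 != 0)) ?invr_neq0 //.
apply: eq_bigr => u _.
have -> : 1 - v^-1 * u = (v - u) * v^-1 by field.
have -> : 1 - v^-1 = - (1 - v) * v^-1 by field.
have -> : v^-1 - v^-1 * u = (1 - u) * v^-1 by field.
rewrite !(chipowM chiP) !(chipowN chiP) !(chipowV chiP) signr_odd.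
by rewrite !mulnDr !chipowD; ring.
Qed.

Lemma conf_sum_swapdc l :
  conf_sum l = (-1) ^+ (swap 3 l).1 * conf_sum (swap 3 l).2.
Proof.
case: l => [[[[i j] k] m] n] /=; rewrite exchange_big /= mulr_sumr.
apply: eq_bigr => d _; rewrite mulr_sumr; apply: eq_bigr => c _.
by rewrite signr_odd -[d - c]opprB (chipowN chiP); ring.
Qed.

Lemma conf_sum_swap s l :
  conf_sum l = (-1) ^+ (swap s l).1 * conf_sum (swap s l).2.
Proof.
case: s => [|[|[|s]]]; [exact: conf_sum_swap_oo0|exact: conf_sum_swap01
  |exact: conf_sum_swap1d|exact: conf_sum_swapdc].
Qed.

Lemma conf_sum_swap_word w (b : bool) l :
  (-1) ^+ b * conf_sum l =
  (-1) ^+ (swap_word w (b, l)).1 * conf_sum (swap_word w (b, l)).2.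
Proof.
elim: w b l => //= s w IHw b l; rewrite (conf_sum_swap s l).
by case: (swap s l) => b' l' /=; rewrite mulrA -signr_addb IHw.
Qed.

Lemma conf_sum_orbit (b : bool) l l' : (b, l') \in label_orbit l ->
  conf_sum l = (-1) ^+ b * conf_sum l'.
Proof.
by case/mapP => w _ e; have := conf_sum_swap_word w false l; rewrite mul1r -e.
Qed.

(** Without a character at [d - c], the sum over all pairs is a product; the
    pairs with [c = d] are to be removed. *)
Lemma conf_sum_split i j k m :
  conf_sum (i, j, k, m, 0)%N = jac i j * jac k m - jac (i + k) (j + m).
Proof.
rewrite /= mulr_suml -sumrB; apply: eq_bigr => c _.
rewrite mulr_sumr !chipowD (bigD1 c) //= subrr chipow0 mulr0 add0r.
rewrite [in RHS](bigD1 c) //= [X in X + _ - _]mulrACA [RHS]addrAC subrr add0r.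
apply: eq_bigr => d dc.
by rewrite (@chipow_neq0 _ _ 0) ?subr_eq0 // expr0; ring.
Qed.

(** The label of the complex conjugate sum. *)
Definition label_conj (l : label) : label :=
  let: (i, j, k, m, n) := l in
  ((3 * i) %% 4, (3 * j) %% 4, (3 * k) %% 4, (3 * m) %% 4, (3 * n) %% 4)%N.

Lemma conf_sum_conj l : (conf_sum l)^* = conf_sum (label_conj l).
Proof.
case: l => [[[[i j] k] m] n] /=; rewrite rmorph_sum; apply: eq_bigr => c _.
rewrite rmorph_sum; apply: eq_bigr => d _.
by rewrite !(chipow_mod4 chiP) 4!rmorphM /= !(chipow_conj chiP).
Qed.
End SymmetricGroup.

(** * Evaluation of the 1024 configuration sums *)

(** All labels with entries in [0 .. 3]. *)
Definition labels : seq label :=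
  let extend T (s : seq T) := [seq (x, i) | x <- s, i <- iota 0 4] in
  extend _ (extend _ (extend _ (extend _ (iota 0 4)))).

(** The coefficients of the Jacobi sum [jac j k] on 1, [q], [jac 1 2] and
    [jac 3 2], in this order. *)
Definition jac_form (j k : nat) : int * int * int * int :=
  match j %% 4, k %% 4 with
  | 0, 0 => (- 2%:Z, 1, 0, 0)%R
  | 0, _ | _, 0 | 2, 2 => (- 1, 0, 0, 0)%R
  | 1, 3 | 3, 1 => (1, 0, 0, 0)%R
  | 1, 1 => (0, 0, - 1, 0)%R
  | 1, _ | _, 1 => (0, 0, 1, 0)%R
  | 3, 3 => (0, 0, 0, - 1)%R
  | _, _ => (0, 0, 0, 1)%R
  end%N.

(** A list of integers, read as coefficients on the list
    1, [q], [p], [p'], [q ^ 2], [q p], [q p'], [p ^ 2], [p p'], [p' ^ 2], [t]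
    where [p], [p'] are [jac 1 2], [jac 3 2] and [t] is
    [conf_sum (1, 2, 2, 2, 3)]; missing coefficients are zero. *)
Definition form := seq int.

Fixpoint form_eval (e : seq algC) (u : form) : algC :=
  match e, u with
  | x :: e', a :: u' => a%:~R * x + form_eval e' u'
  | _, _ => 0
  end.

Fixpoint form_add (u v : form) : form :=
  match u, v with
  | a :: u', b :: v' => (a + b) :: form_add u' v'
  | [::], _ => v
  | _, [::] => u
  end.

Definition form_signed (b : bool) (u : form) : form :=
  if b then [seq - a | a <- u] else u.

(** The form of [jac i j * jac k m - jac i' j']. *)
Definition jac_form_split (a b c : int * int * int * int) : form :=
  let: (a0, a1, a2, a3) := a in
  let: (b0, b1, b2, b3) := b in
  let: (c0, c1, c2, c3) := c in
  [:: a0 * b0 - c0; a0 * b1 + a1 * b0 - c1; a0 * b2 + a2 * b0 - c2;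
      a0 * b3 + a3 * b0 - c3; a1 * b1; a1 * b2 + a2 * b1; a1 * b3 + a3 * b1;
      a2 * b2; a2 * b3 + a3 * b2; a3 * b3].

(** A form with the same real part as the configuration sum of [l]. The real
    part is zero when some permutation of the points changes the sign of the
    sum, or turns the sum into minus its conjugate. If some permutation
    makes the exponent attached to [c d] trivial, the sum splits. The other
    labels are the 30 images of [(1, 2, 2, 2, 3)], and [(2, 2, 2, 2, 2)]. *)
Definition conf_form (l : label) : option form :=
  let o := label_orbit l in
  if ((true, l) \in o) || ((true, label_conj l) \in o) then Some [::]
  else if [seq sl <- o | sl.2.2 == 0%N] is (b, (i, j, k, m, _)) :: _ then
    Some (form_signed b
      (jac_form_split (jac_form i j) (jac_form k m) (jac_form (i + k) (j + m))))
  else if [seq sl <- o | sl.2 == (1, 2, 2, 2, 3)%N] is (b, _) :: _ then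
    Some (form_signed b [:: 0; 0; 0; 0; 0; 0; 0; 0; 0; 0; 1])
  else if l == (2, 2, 2, 2, 2)%N then Some [:: 0; 0; 0; 0; 0; 0; 0; 1; 0; 1]
  else None.

Section Evaluation.
Variables (F : finFieldType) (chi : F -> algC) (g : F).
Hypothesis chiP : odd_quartic_character chi g.

Local Notation q := (#|F|%:R : algC).
Local Notation X := (chipow chi).
Local Notation jac := (jac chi).
Local Notation conf_sum := (conf_sum chi).
Local Notation p := (jac 1 2).
Local Notation p' := (jac 3 2).
Local Notation t := (conf_sum (1, 2, 2, 2, 3)%N).

Definition form_basis : seq algC :=
  [:: 1; q; p; p'; q ^+ 2; q * p; q * p'; p ^+ 2; p * p'; p' ^+ 2; t].

Local Notation ev := (form_eval form_basis).

Lemma form_eval_nil e : form_eval e [::] = 0.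
Proof. by case: e. Qed.

Lemma form_eval_conj e u : (form_eval e u)^* = form_eval [seq x^* | x <- e] u.
Proof.
elim: e u => [|x e IHe] [|a u] /=; rewrite ?rmorph0 //.
by rewrite rmorphD rmorphM /= rmorph_int IHe.
Qed.

Lemma form_eval_add e u v :
  form_eval e (form_add u v) = form_eval e u + form_eval e v.
Proof.
elim: e u v => [|x e IHe] [|a u] [|b v] //=; rewrite ?addr0 ?add0r //.
by rewrite IHe intrD; ring.
Qed.

Lemma form_eval_signed e b u :
  form_eval e (form_signed b u) = (-1) ^+ b * form_eval e u.
Proof.
case: b; rewrite ?mul1r ?mulN1r //=.
by elim: e u => [|x e IHe] [|a u] //=; rewrite ?oppr0 // IHe intrN; ring.
Qed.

Lemma jac_formP j k : let: (a0, a1, a2, a3) := jac_form j k in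
  jac j k = a0%:~R + a1%:~R * q + a2%:~R * p + a3%:~R * p'.
Proof.
have E : jac j k = jac (j %% 4) (k %% 4).
  by apply: (eq_jac chiP); rewrite modn_mod.
have d3 : jac 3 3 = - p' by rewrite (jac_diag chiP).
have d1 : jac 1 1 = - p by rewrite (jac_diag chiP).
have d13 : jac 1 3 = 1 by rewrite (jac_inv chiP (j := 1)) // expr1 opprK.
have d22 := jac22 chiP.
have d0 i : jac 0 i = _ := jac0 chiP i.
rewrite E /jac_form.
have : (j %% 4 < 4)%N by rewrite ltn_mod.
have : (k %% 4 < 4)%N by rewrite ltn_mod.
case: (j %% 4)%N => [|[|[|[|]]]] //; case: (k %% 4)%N => [|[|[|[|]]]] // _ _ /=;
  rewrite ?d0 ?[jac _ 0]jacC ?[jac 2 1]jacC ?[jac 2 3]jacC ?[jac 3 1]jacC;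
  rewrite ?d0 ?d1 ?d3 ?d13 ?d22 /=; ring.
Qed.

Lemma jac_form_splitP i j k m i' j' :
  ev (jac_form_split (jac_form i j) (jac_form k m) (jac_form i' j')) =
  jac i j * jac k m - jac i' j'.
Proof.
have := jac_formP i j; have := jac_formP k m; have := jac_formP i' j'.
case: (jac_form i j) => [[[a0 a1] a2] a3].
case: (jac_form k m) => [[[b0 b1] b2] b3].
case: (jac_form i' j') => [[[c0 c1] c2] c3] -> -> ->.
by rewrite /= !(intrD, intrN, intrM); ring.
Qed.

Lemma conf_formP l u : conf_form l = Some u ->
  conf_sum l + (conf_sum l)^* = ev u + (ev u)^*.
Proof.
rewrite /conf_form.
(* The orbit, a list of 120 labels, is generalized so that it stays folded. *)
have: forall (b : bool) l', (b, l') \in label_orbit l ->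
  conf_sum l = (-1) ^+ b * conf_sum l'.
  by move=> b l' /(conf_sum_orbit chiP).
move: (label_orbit l) => o oP.
have [odd_l|_] := boolP ((true, l) \in o).
  case=> <-; have /eqP := oP _ _ odd_l.
  rewrite expr1 mulN1r -addr_eq0 -mulr2n mulrn_eq0 /= => /eqP->.
  by rewrite rmorph0.
have [odd_l|_] /= := boolP ((true, label_conj l) \in o).
  case=> <-; have := oP _ _ odd_l.
  rewrite expr1 mulN1r -(conf_sum_conj chiP) => {1}->.
  by rewrite addNr rmorph0 addr0.
case e : [seq sl <- o | sl.2.2 == 0%N] => [|[b [[[[i j] k] m] n]] s].
  case e' : [seq sl <- o | sl.2 == (1, 2, 2, 2, 3)%N] => [|[b l'] s].
    have [->|//] := eqVneq l (2, 2, 2, 2, 2)%N.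
    case=> <-; rewrite (conf_sum_quadratic chiP).
    suff -> : p ^+ 2 + p' ^+ 2 = ev [:: 0; 0; 0; 0; 0; 0; 0; 1; 0; 1] by [].
    by rewrite /=; ring.
  have [/= /eqP l'E /oP h] : (b, l').2 == (1, 2, 2, 2, 3)%N /\ (b, l') \in o.
    by apply/andP; rewrite -(mem_filter (fun sl => sl.2 == _)) e' mem_head.
  case=> <-; rewrite l'E in h.
  suff -> : conf_sum l =
    ev (form_signed b [:: 0; 0; 0; 0; 0; 0; 0; 0; 0; 0; 1]) by [].
  by rewrite form_eval_signed h; congr (_ * _);
  rewrite /form_basis; set t := conf_sum _; rewrite /=; ring.
have [/= /eqP n0 /oP h] : (b, (i, j, k, m, n)).2.2 == 0%N /\
    (b, (i, j, k, m, n)) \in o.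
  by apply/andP; rewrite -(mem_filter (fun sl => sl.2.2 == _)) e mem_head.
case=> <-; rewrite n0 in h; suff -> : conf_sum l = ev (form_signed b
    (jac_form_split (jac_form i j) (jac_form k m) (jac_form (i + k) (j + m)))).
  by [].
by rewrite form_eval_signed jac_form_splitP h (conf_sum_split).
Qed.

Lemma conf_form_defined : all (fun l => conf_form l) labels.
Proof. by vm_compute. Qed.

Lemma sum_conf_form (s : seq label) : all (fun l => conf_form l) s ->
  \sum_(l <- s) conf_sum l + (\sum_(l <- s) conf_sum l)^*
  = ev (foldr form_add [::] (pmap conf_form s))
    + (ev (foldr form_add [::] (pmap conf_form s)))^*.
Proof.
move: form_basis conf_formP => B BP.
elim: s => [|l s IHs] /=; first by rewrite big_nil form_eval_nil.
case e : (conf_form l) => [u|//] /= /IHs {}IHs.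
rewrite big_cons /= form_eval_add !rmorphD /=.
by rewrite addrACA (BP _ _ e) IHs addrACA.
Qed.


Lemma sum_labels_prod (A B C D E : nat -> algC) :
  \sum_(l <- labels) (let: (i, j, k, m, n) := l in A i * B j * C k * D m * E n)
  = (\sum_(i <- iota 0 4) A i) * (\sum_(i <- iota 0 4) B i)
    * (\sum_(i <- iota 0 4) C i) * (\sum_(i <- iota 0 4) D i)
    * (\sum_(i <- iota 0 4) E i).
Proof.
rewrite /labels; move: (iota 0 4) => I; rewrite !big_allpairs !mulr_suml.
apply: eq_bigr => i _; rewrite [A i * _]mulr_sumr !mulr_suml.
apply: eq_bigr => j _; rewrite [_ * B j * _]mulr_sumr !mulr_suml.
apply: eq_bigr => k _; rewrite [_ * C k * _]mulr_sumr !mulr_suml.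
by apply: eq_bigr => m _; rewrite mulr_sumr.
Qed.

Lemma sum_labels : \sum_(l <- labels) conf_sum l =
  let Q a := \sum_(i <- iota 0 4) X i a in
  \sum_c \sum_d Q c * Q (1 - c) * Q d * Q (1 - d) * Q (d - c).
Proof.
pose term c d (l : label) := let: (i, j, k, m, n) := l in
  X i c * X j (1 - c) * X k d * X m (1 - d) * X n (d - c).
transitivity (\sum_(l <- labels) \sum_c \sum_d term c d l).
  by apply: eq_bigr => [[[[[i j] k] m] n]].
rewrite exchange_big /=; apply: eq_bigr => c _.
rewrite exchange_big /=; apply: eq_bigr => d _; exact: sum_labels_prod.
Qed.

(** The indicator of the nonzero fourth powers. *)
Definition fourth (a : F) : bool := (a != 0) && [exists c : F, a == c ^+ 4].

Lemma fourth_chi a : a != 0 -> fourth a = (chi a == 1).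
Proof.
move=> a0; rewrite /fourth a0 /=; apply/existsP/eqP => [[c /eqP ac]|].
  rewrite ac (chiX chiP) (chi_exp4 chiP) //.
  by apply: contraNneq a0 => c0; rewrite ac c0 expr0n.
have [k ak] := oqc_gen chiP a0; rewrite ak (chiX chiP) => gk.
have {gk}: chi g ^+ (k %% 4) = 1.
  move: gk; rewrite {1}(divn_eq k 4) exprD mulnC exprM (chi_gen4 chiP).
  by rewrite expr1n mul1r.
have m1 := negPf algC_N1_neq1; have g2 := oqc_sqr_gen chiP.
case e : (k %% 4)%N (ltn_pmod k (isT : (0 < 4)%N)) => [|[|[|[|//]]]] _ gk.
- exists (g ^+ (k %/ 4)); rewrite -exprM; apply/eqP; congr (_ ^+ _); lia.
- by move/eqP: g2; rewrite -(expr1 (chi g)) gk expr1n eq_sym m1.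
- by move/eqP: g2; rewrite gk eq_sym m1.
- have /eqP := congr1 (fun z => z ^+ 2) gk.
  by rewrite expr1n exprAC g2 exprS sqrrN expr1n mulr1 m1.
Qed.

Lemma sum_chipow_exponents a :
  \sum_(i <- iota 0 4) X i a = 4 * (fourth a)%:R.
Proof.
rewrite !big_cons big_nil addr0.
have [->|a0] := eqVneq a 0; first by rewrite !chipow0 /fourth eqxx mulr0 !addr0.
rewrite !chipow_neq0 // fourth_chi // expr0 expr1.
have [->|a1] := eqVneq (chi a) 1; first by rewrite !expr1n mulr1; ring.
rewrite mulr0; apply: (mulfI (x := chi a - 1)); first by rewrite subr_eq0.
transitivity (chi a ^+ 4 - 1); first by ring.
by rewrite (chi_exp4 chiP) // subrr mulr0.
Qed.

Lemma sum_fourth : \sum_a (fourth a)%:R = (q - 1) / 4 :> algC.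
Proof.
have n4 : 4 != 0 :> algC by rewrite pnatr_eq0.
apply: (mulfI n4); rewrite mulr_sumr mulrCA divff // mulr1.
transitivity (\sum_a \sum_(i <- iota 0 4) X i a).
  by apply: eq_bigr => a _; rewrite sum_chipow_exponents.
rewrite exchange_big /= !big_cons big_nil !(sum_chipow chiP) /=.
by rewrite !addr0.
Qed.

Lemma fourthM s a : fourth s -> fourth (s * a) = fourth a.
Proof.
move=> fs; have s0 : s != 0 by case/andP: fs.
have [->|a0] := eqVneq a 0; first by rewrite mulr0.
rewrite !fourth_chi ?mulf_neq0 // (oqc_mul chiP).
by move: fs; rewrite fourth_chi // => /eqP->; rewrite mul1r.
Qed.

Lemma conf_sum_T_real : t^* = t.
Proof.
rewrite (conf_sum_conj chiP).
have /(conf_sum_orbit chiP) : (false, (1, 2, 2, 2, 3)%N)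
  \in label_orbit (label_conj (1, 2, 2, 2, 3)%N) by vm_compute.
by rewrite mul1r.
Qed.

(** The number of pairs [c], [d] for which [c], [1 - c], [d], [1 - d] and
    [d - c] are nonzero fourth powers; it is a real number, so that the real
    parts of the configuration sums suffice. *)
Lemma count_fourth_pairs :
  4 ^+ 5 * \sum_c \sum_d ((fourth c)%:R * (fourth (1 - c))%:R * (fourth d)%:R
     * (fourth (1 - d))%:R * (fourth (d - c))%:R)
  = q ^+ 2 + 5 * q * (p + p') - 42 * q + 6 * (p + p') ^+ 2
    - 75 * (p + p') + 241 - 10 * t.
Proof.
set N := \sum_c _.
have NE : \sum_(l <- labels) conf_sum l = 4 ^+ 5 * N.
  rewrite sum_labels mulr_sumr; apply: eq_bigr => c _.
  rewrite mulr_sumr; apply: eq_bigr => d _.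
  by rewrite !sum_chipow_exponents; ring.
have Nr : N^* = N.
  rewrite rmorph_sum; apply: eq_bigr => c _; rewrite rmorph_sum.
  by apply: eq_bigr => d _; rewrite -!natrM rmorph_nat.
have := sum_conf_form conf_form_defined.
(* Computed over the 1024 labels and the 120 permutations. *)
have E : foldr form_add [::] (pmap conf_form labels)
  = [:: 241%:Z; - 40%:Z; - 75%:Z; - 75%:Z; 1; 5%:Z; 5%:Z; 6%:Z; 10%:Z; 6%:Z;
        - 10%:Z].
  by vm_compute.
rewrite NE E form_eval_conj {E}.
have -> : (4 ^+ 5 * N)^* = 4 ^+ 5 * N.
  by rewrite rmorphM /= Nr rmorphXn /= rmorph_nat.
have pJ : p^* = p' by rewrite (jac_conj chiP); apply: (eq_jac chiP).
have p'J : p'^* = p by rewrite -pJ conjCK.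
have -> : [seq x^* | x <- form_basis]
  = [:: 1; q; p'; p; q ^+ 2; q * p'; q * p; p' ^+ 2; p' * p; p ^+ 2; t].
  rewrite /form_basis 10!map_cons /= conf_sum_T_real.
  by rewrite !rmorphM !rmorph_nat rmorph1 /= pJ p'J.
have := jac_norm chiP; rewrite /form_basis.
move: p p' t q (4 ^+ 5 * N) => P P' T q0 M <- h.
apply: (mulfI (x := 2)); first by rewrite pnatr_eq0.
transitivity (M + M); first by ring.
rewrite h /=; ring.
Qed.
End Evaluation.

(** * Transitive subtournaments as ordered tuples *)

(** The transitive subtournament with vertices listed by [t]. *)
Definition listed_subtournament (m : nat) (T : finType) (t : m.-tuple T) :
    {set T} * {set T * T} :=
  ([set a in t],
   [set u | [exists i : 'I_m, exists j : 'I_m,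
     (i < j)%N && (u == (tnth t i, tnth t j))]]).

Lemma pairwise_tnthP (m : nat) (T : eqType) (e : rel T) (t : m.-tuple T) :
  reflect (forall i j : 'I_m, (i < j)%N -> e (tnth t i) (tnth t j))
          (pairwise e t).
Proof.
apply: (iffP idP) => [pt i j ij|h].
  have x0 := tnth t i; rewrite !(tnth_nth x0).
  by move/(pairwiseP x0): pt; apply; rewrite // inE size_tuple.
case: m t h => [|m] t h; first by rewrite tuple0.
move: (tnth t ord0) => x0.
apply/(pairwiseP x0) => i j; rewrite !inE size_tuple => im jm ij.
by have := h (Ordinal im) (Ordinal jm) ij; rewrite !(tnth_nth x0).
Qed.

Section CountSubtournaments.
Variables (m : nat) (T : finType) (e : rel T).
Hypothesis e_irr : irreflexive e.

Lemma pairwise_irr_uniq (t : m.-tuple T) : pairwise e t -> uniq t.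
Proof.
move/pairwise_tnthP=> h; apply/tuple_uniqP => i j tij; apply: val_inj => /=.
by case: (ltngtP i j) => // /h; rewrite tij e_irr.
Qed.

Lemma mem_listed_arc (t : m.-tuple T) (i j : 'I_m) : uniq t ->
  ((tnth t i, tnth t j) \in (listed_subtournament t).2) = (i < j)%N.
Proof.
move=> /tuple_uniqP t_inj; rewrite inE.
apply/existsP/idP => [[i' /existsP[j']]|ij].
  by case/andP=> ij /eqP[/t_inj-> /t_inj->].
by exists i; apply/existsP; exists j; rewrite ij eqxx.
Qed.

Lemma listed_subtournament_inj :
  {in [pred t : m.-tuple T | uniq t] &, injective (@listed_subtournament m T)}.
Proof.
move=> t t' /= ut ut' tt'; apply: val_inj => /=.
pose r a b := (a, b) \in (listed_subtournament t).2.
have ijP a b : r a b ->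
    exists i j : 'I_m, [/\ (i < j)%N, a = tnth t i & b = tnth t j].
  rewrite /r inE => /existsP[i /existsP[j /andP[ij /eqP[-> ->]]]].
  by exists i, j.
apply: (irr_sorted_eq (leT := r)).
- move=> b a c /ijP[i [j [ij -> bE]]] /ijP[k [l [kl bE' ->]]].
  move/tuple_uniqP: ut (ut) => t_inj ut; rewrite /r mem_listed_arc //.
  by move: bE; rewrite bE' => /t_inj kj; apply: ltn_trans ij _; rewrite -kj.
- move=> a; apply/negP => /ijP[i [j [ij ai aj]]].
  move: ij; move/tuple_uniqP: ut => /(_ i j).
  by rewrite -ai -aj => ->; rewrite ?ltnn.
- by apply/pairwise_sorted/pairwise_tnthP => i j ij; rewrite /r mem_listed_arc.
- apply/pairwise_sorted/pairwise_tnthP => i j ij.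
  by rewrite /r tt' mem_listed_arc.
- by move=> a; have /setP/(_ a) := congr1 fst tt'; rewrite /= !inE.
Qed.

(** A transitive tournament has exactly one transitive listing. *)
Lemma num_transitive_subtournamentsE :
  num_transitive_subtournaments m e = #|[set t : m.-tuple T | pairwise e t]|.
Proof.
rewrite -(card_in_imset (f := @listed_subtournament m T)); last first.
  move=> t t'; rewrite !inE => /pairwise_irr_uniq ut /pairwise_irr_uniq ut'.
  exact: listed_subtournament_inj.
congr #|pred_of_set _|; apply/setP => H; rewrite inE; apply/idP/imsetP.
  case: H => V A /= /and4P[/eqP cardV /andP[/= AV Ae] /= tourn].
  case/existsP=> t /and3P[ut /eqP/= tV /forallP tA].
  have {}tA (i j : 'I_m) : (i < j)%N -> (tnth t i, tnth t j) \in A.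
    by move=> ij; move/(_ i): tA => /forallP/(_ j)/implyP/(_ ij).
  exists t.
    rewrite inE; apply/pairwise_tnthP => i j /tA.
    by move/forall_inP: Ae => h /h.
  rewrite /listed_subtournament tV; congr (_, _).
  apply/setP => -[a b]; rewrite inE; apply/idP/idP.
    move=> abA; have := subsetP AV _ abA; rewrite inE -tV !inE /=.
    case/andP=> /tnthP[i ai] /tnthP[j bj].
    have aV : a \in V by rewrite -tV inE ai mem_tnth.
    have bV : b \in V by rewrite -tV inE bj mem_tnth.
    have := forall_inP (forall_inP tourn a aV) b bV; rewrite abA.
    have [//|ab /= baA] := eqVneq a b.
    apply/existsP; exists i; apply/existsP; exists j.
    rewrite -ai -bj eqxx andbT.
    case: (ltngtP i j) => // [ji|/val_inj ij]; last first.
      by rewrite ai bj ij eqxx in ab.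
    by move: baA; rewrite ai bj tA.
  by case/existsP=> i /existsP[j /andP[ij /eqP[-> ->]]]; apply: tA.
case=> t; rewrite inE => pt ->; have ut := pairwise_irr_uniq pt.
apply/and4P; split.
- by rewrite /= cardsE (card_uniqP ut) size_tuple.
- apply/andP; split; last first.
    apply/forall_inP => -[a b]; rewrite inE.
    case/existsP=> i /existsP[j /andP[ij /eqP[-> ->]]].
    by move/pairwise_tnthP: pt; apply.
  apply/subsetP => -[a b]; rewrite /= inE.
  by case/existsP=> i /existsP[j /andP[_ /eqP[-> ->]]]; rewrite !inE !mem_tnth.
- apply/forall_inP => a; rewrite inE => /tnthP[i ->].
  apply/forall_inP => b; rewrite inE => /tnthP[j ->].
  rewrite !mem_listed_arc //; case: eqP => [|ij].
    by move/tuple_uniqP: ut => /[apply] ->; rewrite ltnn.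
  by case: (ltngtP i j) => // /val_inj e_ij; rewrite e_ij in ij.
- apply/existsP; exists t; rewrite ut eqxx /=.
  apply/forallP => i; apply/forallP => j.
  by rewrite mem_listed_arc //; apply/implyP.
Qed.
End CountSubtournaments.

Section CountFourTuples.
Variables (F : finFieldType) (chi : F -> algC) (g : F).
Hypothesis chiP : odd_quartic_character chi g.

Local Notation q := (#|F|%:R : algC).

(** Translation and dilation bring the first and last vertices to 0 and 1. *)
Lemma num_transitive_subtournaments4 :
  (num_transitive_subtournaments 4 (@fourth_power_digraph F))%:R
  = q * (q - 1) / 4 * \sum_(c : F) \sum_(d : F)
      ((fourth c)%:R * (fourth (1 - c))%:R * (fourth d)%:R
       * (fourth (1 - d))%:R * (fourth (d - c))%:R) :> algC.
Proof.
have eE (a b : F) : fourth_power_digraph a b = fourth (b - a) by [].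
have e_irr : irreflexive (@fourth_power_digraph F).
  by move=> a; rewrite eE subrr /fourth eqxx.
rewrite (num_transitive_subtournamentsE _ e_irr).
set N := \sum_c _.
transitivity (\sum_(a : F) \sum_(s : F) (fourth s)%:R * N); last first.
  rewrite sumr_const -mulr_suml (sum_fourth chiP) -[LHS]mulr_natl !mulrA.
  by congr (_%:R * _ * _ * _); apply: eq_card.
pose tuple4 (u : F * F * F * F) := let: (a, s, c, d) := u in [tuple a; c; d; s].
transitivity (\sum_a \sum_s \sum_c \sum_d
   (pairwise (@fourth_power_digraph F) (tuple4 (a, s, c, d)))%:R : algC).
  rewrite !pair_big /= -sum1_card natr_sum big_mkcond /=.
  rewrite [LHS](reindex tuple4) /=.
    apply: eq_bigr => -[[[a s] c] d] _; rewrite inE; exact/esym/mulrb.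
  exists (fun t : 4.-tuple F => (tnth t 0, tnth t 3, tnth t 1, tnth t 2)).
    by case=> -[[a s] c] d _.
  move=> t _; apply: eq_from_tnth => i; rewrite (tnth_nth 0).
  by case: i => [[|[|[|[|//]]]] hi] /=; congr tnth; apply: val_inj.
apply: eq_bigr => a _; rewrite -(sum_shift _ a); apply: eq_bigr => s _.
rewrite mulr_sumr -(sum_shift _ a).
have [fs|nfs] := boolP (fourth s); last first.
  rewrite !big1 // => c _; first by rewrite mul0r.
  by rewrite big1 // => d _; rewrite /= !eE !addrK (negPf nfs) !andbF.
have s0 : s != 0 by case/andP: fs.
rewrite -(sum_scale _ s0); apply: eq_bigr => c _.
rewrite mul1r -(sum_shift _ a) -(sum_scale _ s0); apply: eq_bigr => d _.
have sh (x y : F) : x + a - (y + a) = x - y by ring.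
have s1 (x : F) : s - s * x = s * (1 - x) by ring.
rewrite /= !eE !addrK !sh !s1 -mulrBr !(fourthM chiP _ fs) fs.
move: (fourth c) (fourth (1 - c)) (fourth d) (fourth (1 - d)) (fourth (d - c)).
by move=> [] [] [] [] []; rewrite /= ?(mulr0, mul0r, mulr1).
Qed.
End CountFourTuples.

(** * Multiplicative characters and the hypergeometric function *)

Section MultiplicativeCharacters.
Variable F : finFieldType.
Local Notation U := [set: {unit F}]%G.
Local Notation q := (#|F|%:R : algC).
Implicit Types (A B C chi : 'CF(U)) (a b : F).

Lemma chval_unit A (u : {unit F}) : chval A (val u) = A u.
Proof. by rewrite /chval valK. Qed.

Lemma chval0 A : chval A 0 = 0.
Proof. by rewrite /chval insubF // unitr0. Qed.

Lemma neq0_unit a : a != 0 -> exists u : {unit F}, a = val u.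
Proof. by move=> a0; exists (FinRing.unit F (etrans (unitfE a) a0)). Qed.

Lemma chvalMr A B a : chval (A * B) a = chval A a * chval B a.
Proof.
have [->|/neq0_unit[u ->]] := eqVneq a 0; first by rewrite !chval0 mul0r.
by rewrite !chval_unit cfunE.
Qed.

Lemma chvalM A a b : A \is a linear_char ->
  chval A (a * b) = chval A a * chval A b.
Proof.
move=> linA; have [->|/neq0_unit[u ->]] := eqVneq a 0.
  by rewrite mul0r chval0 mul0r.
have [->|/neq0_unit[v ->]] := eqVneq b 0; first by rewrite mulr0 chval0 mulr0.
by rewrite -FinRing.val_unitM !chval_unit lin_charM ?inE.
Qed.

Lemma chval1 A : A \is a linear_char -> chval A 1 = 1.
Proof.
by move=> linA; rewrite -(FinRing.val_unit1 F) chval_unit lin_char1.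
Qed.

Lemma chval_inv A a : A \is a linear_char -> chval A^-1 a = chval A a^-1.
Proof.
move=> linA; have [->|/neq0_unit[u ->]] := eqVneq a 0.
  by rewrite invr0 !chval0.
rewrite -FinRing.val_unitV !chval_unit invr_lin_char // cfunE.
by rewrite lin_charV_conj ?inE.
Qed.

Lemma irr_mult_lin_char (i : Iirr U) : 'chi_i \is a linear_char.
Proof.
exact/char_abelianP/cyclic_abelian/field_unit_group_cyclic.
Qed.

Lemma sum_irr_chval a :
  \sum_(i : Iirr U) chval 'chi_i a = (q - 1) * (a == 1)%:R.
Proof.
have [->|/neq0_unit[u ->]] := eqVneq a 0.
  rewrite big1 ?[0 == 1]eq_sym ?oner_eq0 ?mulr0 // => i _; exact: chval0.
have -> : (val u == 1) = (u == 1%g) by rewrite -(FinRing.val_unit1 F) val_eqE.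
have -> : q - 1 = #|U|%:R.
  rewrite (card_finField_unit F) -subn1 natrB //.
  by apply/card_gt0P; exists 0.
rewrite mulr_natr -cfRegE cfReg_sum sum_cfunE; apply: eq_bigr => i _.
by rewrite cfunE lin_char1 ?irr_mult_lin_char // mul1r chval_unit.
Qed.

(** The substitution [u = a / (a - 1)] in the Jacobi sum defining the binomial
    coefficient; the values [a = 1] and [u = 1] contribute nothing. *)
Lemma char_binom_diag A chi : A \is a linear_char -> chi \is a linear_char ->
  char_binom (A * chi) chi = q^-1 * \sum_u chval A (u / (u - 1)) * chval chi u.
Proof.
move=> linA linchi; rewrite /char_binom mulrAC mulrC; congr (_ * _).
rewrite mulr_sumr (bigD1 (1 : F)) //= subrr chval0 !mulr0 add0r.
rewrite [RHS](bigD1 (1 : F)) //= subrr invr0 mulr0 chval0 mul0r add0r.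
rewrite [RHS](reindex_onto (fun a => a / (a - 1)) (fun u => u / (u - 1))) /=.
  have e a : a != 1 -> a / (a - 1) - 1 = (a - 1)^-1.
    by rewrite -subr_eq0 => a1; field.
  apply: eq_big => [a|a a1].
    have [->|a1] := eqVneq a 1.
      by rewrite subrr invr0 mulr0 mul0r [0 == 1]eq_sym oner_eq0 andbF.
    rewrite -subr_eq0 e // invr_eq0 subr_eq0 a1 invrK divfK ?eqxx //.
    by rewrite subr_eq0.
  have a0 : a - 1 != 0 by rewrite subr_eq0.
  rewrite e // invrK divfK // chvalMr chval_inv // -mulrA mulrCA.
  congr (_ * _).
  rewrite -!(chvalM _ _ linchi); congr chval.
  by rewrite -[1 - a]opprB invrN; ring.
move=> u; rewrite -subr_eq0 => u1.
have -> : u / (u - 1) - 1 = (u - 1)^-1 by field.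
by rewrite invrK divfK.
Qed.

(** By orthogonality, only the triples with [u v w = 1] remain in the product of
    the three binomial coefficients, summed over all characters. *)
Lemma greene_3F2_at1 A B C :
  A \is a linear_char -> B \is a linear_char -> C \is a linear_char ->
  q ^+ 2 * greene_3F2 A B C 1 1 1 =
  \sum_v \sum_w chval A (1 - v * w)^-1 * chval B (v / (v - 1))
                * chval C (w / (w - 1)).
Proof.
move=> linA linB linC; rewrite /greene_3F2.
have q1 : (1 < #|F|)%N.
  by rewrite (cardD1 0) (cardD1 1) !inE oner_eq0.
have q0 : q != 0 by rewrite pnatr_eq0; lia.
have qm : q - 1 != 0.
  by rewrite subr_eq0 -[1]/(1%:R) eqr_nat; lia.
pose T u v w : algC := chval A (u / (u - 1)) * chval B (v / (v - 1))
   * chval C (w / (w - 1)).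
transitivity ((q - 1)^-1 * \sum_v \sum_w \sum_u
   T u v w * \sum_(i : Iirr U) chval 'chi_i (u * v * w)).
  transitivity ((q - 1)^-1 * \sum_(i : Iirr U) \sum_v \sum_w \sum_u
     T u v w * chval 'chi_i (u * v * w)).
    transitivity ((q - 1)^-1 * \sum_(i : Iirr U) q ^+ 3 *
      (char_binom (A * 'chi_i) 'chi_i * char_binom (B * 'chi_i) (1 * 'chi_i)
       * char_binom (C * 'chi_i) (1 * 'chi_i) * chval 'chi_i 1)).
      rewrite -mulr_sumr (eq_bigl xpredT) => [|i]; last first.
        exact: irr_mult_lin_char.
      have E (x y z : algC) : y != 0 ->
        x ^+ 2 * (x / y * z) = y^-1 * (x ^+ 3 * z) by move=> y0; field.
      exact: E.
    congr (_ * _); apply: eq_bigr => i _; have lini := irr_mult_lin_char i.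
    rewrite mul1r chval1 // !char_binom_diag // mulr1.
    pose J A' := \sum_u chval A' (u / (u - 1)) * chval 'chi_i u.
    transitivity (J B * (J C * J A)).
      have E (x s t u : algC) : x != 0 ->
        x ^+ 3 * (x^-1 * s * (x^-1 * t) * (x^-1 * u)) = t * (u * s).
        by move=> x0; field.
      exact: E.
    rewrite /J mulr_suml; apply: eq_bigr => v _.
    rewrite mulr_suml mulr_sumr; apply: eq_bigr => w _.
    rewrite !mulr_sumr; apply: eq_bigr => u _.
    by rewrite /T !(chvalM _ _ lini); ring.
  congr (_ * _); rewrite exchange_big; apply: eq_bigr => v _.
  rewrite exchange_big; apply: eq_bigr => w _.
  rewrite exchange_big; apply: eq_bigr => u _.
  by rewrite mulr_sumr.
rewrite mulr_sumr; apply: eq_bigr => v _.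
rewrite mulr_sumr; apply: eq_bigr => w _.
have [->|v0] := eqVneq v 0.
  rewrite big1 ?mulr0 ?mul0r ?chval0 ?mulr0 ?mul0r // => u _.
  by rewrite /T mul0r chval0 mulr0 !mul0r.
have [->|w0] := eqVneq w 0.
  rewrite big1 ?mulr0 ?mul0r ?chval0 ?mulr0 ?mul0r // => u _.
  by rewrite /T mul0r chval0 mulr0 !mul0r.
rewrite (bigD1 (v * w)^-1) //= [X in _ * (_ + X)]big1 => [|u uvw].
  rewrite addr0 sum_irr_chval -[_ * v * w]mulrA mulVf ?mulf_neq0 // eqxx mulr1.
  rewrite mulrCA mulVf // mulr1 /T; congr (chval A _ * _ * _).
  have [vw1|vw1] := eqVneq (v * w) 1.
    by rewrite vw1 !subrr invr1 subrr invr0 mulr0.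
  have h : 1 - v * w != 0 by rewrite subr_eq0 eq_sym.
  by field; rewrite v0 w0 h.
rewrite sum_irr_chval (_ : (_ == 1) = false) ?mulr0 //.
apply: contraNF uvw => /eqP e; apply/eqP/(mulIf (mulf_neq0 v0 w0)).
by rewrite mulrA e mulVf ?mulf_neq0.
Qed.

(** When [#|F|] is 5 modulo 8, a character of order 4 is -1 at -1; its square is
    the only character of order 2, the unit group being cyclic. *)
Lemma odd_quartic_chval (phi chi4 : 'CF(U)) :
    #|F| = 5 %[mod 8] -> phi \is a linear_char -> #[phi]%CF = 2%N ->
    chi4 \is a linear_char -> #[chi4]%CF = 4%N ->
  exists2 g, odd_quartic_character (chval chi4) g
    & chval phi =1 chipow (chval chi4) 2.
Proof.
move=> hq linphi ophi linchi ochi.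
have /cyclicP[u uE] : cyclic U by apply: field_unit_group_cyclic.
have genU v : exists k, v = (u ^+ k)%g.
  by apply/cycleP; rewrite -uE inE.
have ou : #[u]%g = #|F|.-1 by rewrite -(card_finField_unit F) uE.
have eqU (A : 'CF(U)) n : A \is a linear_char -> A u ^+ n = 1 ->
    (#[A]%CF %| n)%N.
  move=> linA Au; rewrite dvdn_cforder; apply/eqP/cfun_inP => v _.
  have [k ->] := genU v; rewrite exp_cfunE ?inE // cfun1E inE.
  by rewrite lin_charX ?inE // exprAC Au expr1n.
have ordU (A : 'CF(U)) n : A ^+ n = 1 -> A u ^+ n = 1.
  by move=> An; rewrite -exp_cfunE ?inE // An cfun1E inE.
have phiu : phi u = -1.
  have := ordU phi 2%N; rewrite -{1}ophi exp_cforder => /(_ erefl)/eqP.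
  rewrite sqrf_eq1 => /orP[/eqP h|/eqP//].
  by have := eqU phi 1%N linphi; rewrite expr1 ophi => /(_ h).
have chiu : chi4 u ^+ 2 = -1.
  have := ordU chi4 4%N; rewrite -{1}ochi exp_cforder => /(_ erefl)/eqP.
  rewrite (exprM _ 2 2) sqrf_eq1 => /orP[/eqP h|/eqP//].
  by have := eqU chi4 2%N linchi h; rewrite ochi.
have uval_exp k : val (u ^+ k)%g = val u ^+ k by rewrite FinRing.val_unitX.
have chiX k : chval chi4 (val u ^+ k) = chi4 u ^+ k.
  by rewrite -uval_exp chval_unit lin_charX ?inE.
exists (val u).
  split.
  - exact: chval0.
  - by move=> a b; apply: chvalM.
  - set n := (#|F| %/ 4)%N.
    have nE : (#|F|.-1 = 4 * n)%N by rewrite /n; lia.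
    have n_odd : odd n by rewrite /n; lia.
    have -> : -1 = val u ^+ (2 * n) :> F.
      have /eqP : (val u ^+ (2 * n)) ^+ 2 = 1.
        rewrite -exprM -mulnAC -nE -ou -uval_exp expg_order.
        exact: FinRing.val_unit1.
      rewrite sqrf_eq1 => /orP[|/eqP//].
      rewrite -uval_exp -(FinRing.val_unit1 F) val_eqE -order_dvdn ou nE.
      by move/dvdn_leq; lia.
    by rewrite chiX exprM chiu -signr_odd n_odd.
  - by move=> a /neq0_unit[v ->]; have [k ->] := genU v; exists k.
  - by rewrite chval_unit.
move=> a; have [->|a0] := eqVneq a 0; first by rewrite chval0 chipow0.
have [v ->] := neq0_unit a0; have [k ->] := genU v.
rewrite chval_unit chipow_neq0; last by rewrite -unitfE (valP (u ^+ k)%g).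
by rewrite uval_exp chiX lin_charX ?inE // -exprM mulnC exprM chiu phiu.
Qed.

(** The substitution [v = 1 / c] in [greene_3F2_at1]. *)
Lemma greene_3F2_conf_sum (phi chi4 : 'CF(U)) g :
    odd_quartic_character (chval chi4) g ->
    chval phi =1 chipow (chval chi4) 2 ->
    phi \is a linear_char -> chi4 \is a linear_char ->
  q ^+ 2 * greene_3F2 chi4 phi phi 1 1 1
  = - conf_sum (chval chi4) (1, 2, 2, 2, 3)%N.
Proof.
move=> chiP phiE linphi linchi; rewrite greene_3F2_at1 // /conf_sum -sumrN.
rewrite -sum_inv; apply: eq_bigr => c _; rewrite -sumrN; apply: eq_bigr => w _.
rewrite !phiE -[chval chi4 _]expr1.
have [->|c0] := eqVneq c 0.
  by rewrite invr0 !mul0r !chipow0 !(mulr0, mul0r) oppr0.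
have -> : chval chi4 (1 - c^-1 * w)^-1 ^+ 1
    = chipow (chval chi4) 1 (1 - c^-1 * w)^-1.
  have [h|h] := eqVneq (1 - c^-1 * w) 0.
    by rewrite h invr0 chipow0 expr1 chval0.
  by rewrite chipow_neq0 ?invr_eq0.
have -> : c^-1 / (c^-1 - 1) = (1 - c)^-1.
  have [->|c1] := eqVneq c 1; first by rewrite invr1 subrr invr0 mulr0.
  have h : 1 - c != 0 by rewrite subr_eq0 eq_sym.
  by field; rewrite h c0.
have -> : w / (w - 1) = - w * (1 - w)^-1.
  by rewrite -[w - 1]opprB invrN mulrN mulNr.
have -> : 1 - c^-1 * w = - (w - c) * c^-1 by field.
rewrite !invfM invrK !(chipowM chiP) !(chipowV chiP) !(chipowN chiP).
have e a : chipow (chval chi4) (3 * 2) a = chipow (chval chi4) 2 a.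
  exact: (eq_chipow chiP).
by rewrite !e; ring.
Qed.
End MultiplicativeCharacters.

(** * Sums of two squares *)

(** The binomial coefficient to which a Jacobi sum reduces is prime to [p]: by
    Legendre's formula, since [2 * (m %/ p ^ i) = (2 * m) %/ p ^ i]. *)
Lemma prime_ndvd_central_bin (p r m : nat) : prime p ->
  (p ^ r = 4 * m + 1)%N -> (p ^ r = 5 %[mod 8])%N -> ~~ (p %| 'C(2 * m, m))%N.
Proof.
move=> pp prE pr8.
have p5 : (p %% 8 = 5)%N.
  have p_sq : (p ^ 2 = 1 %[mod 8])%N.
    have : (p %% 8 \in [:: 1; 3; 5; 7])%N.
      have : odd (p ^ r) by lia.
      rewrite oddX; case: r {prE} pr8 => [|r] // _ /=.
      by have := ltn_pmod p (isT : (0 < 8)%N); rewrite !inE; lia.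
    by rewrite -modnXm !inE => /or4P[] /eqP->.
  have : (p ^ r = p ^ odd r %[mod 8])%N.
    have -> : (p ^ r = p ^ odd r * (p ^ 2) ^ r./2)%N.
      by rewrite -expnM -expnD mul2n odd_double_half.
    by rewrite -modnMmr -modnXm p_sq exp1n muln1.
  by rewrite pr8; case: (odd r); rewrite ?expn1 ?expn0.
have p4 i : (p ^ i = 4 * (p ^ i %/ 4) + 1)%N.
  have : (p ^ i %% 4 = 1)%N.
    by rewrite -modnXm (_ : p %% 4 = 1)%N ?exp1n //; lia.
  by move: (p ^ i)%N; lia.
have m_le : (m <= 2 * m)%N by lia.
have C0 : (0 < 'C(2 * m, m))%N by rewrite bin_gt0.
have half i : ((2 * m) %/ p ^ i = 2 * (m %/ p ^ i))%N.
  have pi0 : (0 < p ^ i)%N by rewrite expn_gt0 prime_gt0.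
  have [ri|ir] := ltnP r i.
    have : (p ^ r < p ^ i)%N by rewrite ltn_exp2l ?prime_gt1.
    by move=> h; rewrite !divn_small //; lia.
  have e : (p ^ r = p ^ i * p ^ (r - i))%N by rewrite -expnD subnKC.
  have [a b] := (p4 i, p4 (r - i)%N).
  have mE : (m = (p ^ (r - i) %/ 4) * p ^ i + p ^ i %/ 4)%N.
    move: e; rewrite prE b; move: a.
    by move: (p ^ i)%N (p ^ (r - i) %/ 4)%N (p ^ i %/ 4)%N; nia.
  have m2E : (2 * m = (2 * (p ^ (r - i) %/ 4)) * p ^ i + 2 * (p ^ i %/ 4))%N.
    by rewrite {1}mE mulnDr mulnA.
  have s1 : (p ^ i %/ 4 < p ^ i)%N by move: a; move: (p ^ i)%N => s; lia.
  have s2 : (2 * (p ^ i %/ 4) < p ^ i)%N by move: a; move: (p ^ i)%N => s; lia.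
  rewrite m2E [in RHS]mE !divnMDl // (divn_small s1) (divn_small s2).
  by rewrite !addn0.
have : logn p (2 * m)`! = (logn p 'C(2 * m, m) + (logn p m`! + logn p m`!))%N.
  rewrite -(bin_fact m_le) (_ : 2 * m - m = m)%N; last by lia.
  by rewrite !lognM ?muln_gt0 ?fact_gt0.
have legendre : logn p m`! = (\sum_(1 <= k < (2 * m).+1) m %/ p ^ k)%N.
  rewrite logn_fact // (big_cat_nat (n := m.+1) (p := (2 * m).+1)) //=.
  rewrite [X in (_ + X)%N]big_nat [X in (_ + X)%N]big1 ?addn0 // => k.
  case/andP=> mk _.
  rewrite divn_small //; apply: leq_trans (ltn_expl _ (prime_gt1 pp)).
  by apply: ltnW.
rewrite legendre (logn_fact _ pp) (eq_bigr _ (fun i _ => half i)).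
rewrite -big_distrr /=.
have -> : (p %| 'C(2 * m, m))%N = (0 < logn p 'C(2 * m, m))%N.
  by rewrite logn_gt0 mem_primes pp C0.
by lia.
Qed.

(** A prime power has, up to signs and order, at most one expression as a sum
    of two squares prime to [p]: [p ^ r] divides one of [x b - y a] and
    [x b + y a], which has absolute value at most [p ^ r] by the two-squares
    identity. The congruences fix the order and the sign. *)
Lemma prime_power_sum2_unique (p r : nat) (x y a b : int) : prime p -> odd p ->
  (0 < r)%N -> (p ^ r)%N%:Z = x ^+ 2 + y ^+ 2 ->
  (p ^ r)%N%:Z = a ^+ 2 + b ^+ 2 ->
  ~~ (p %| x)%Z -> ~~ (p %| a)%Z ->
  (x = 1 %[mod 4])%Z -> (a = 1 %[mod 4])%Z -> x = a.
Proof.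
move=> pp p_odd r0 qx qa px pa x4 a4.
have q_odd : odd (p ^ r) by rewrite oddX p_odd orbT.
have core (y' b' : int) : (p ^ r)%N%:Z = x ^+ 2 + y' ^+ 2 ->
    (p ^ r)%N%:Z = a ^+ 2 + b' ^+ 2 -> ((p ^ r)%N%:Z %| x * b' - y' * a)%Z ->
    x = a.
  have q0 : 0 < (p ^ r)%N%:Z by rewrite ltz_nat expn_gt0 prime_gt0.
  move: (p ^ r)%N%:Z q0 (q_odd : odd `|(p ^ r)%N%:Z|%N).
  move=> q q0 {}q_odd qx' qa' /dvdzP[k kE].
  have norm : (k * q) ^+ 2 + (x * a + y' * b') ^+ 2 = q ^+ 2.
    transitivity ((x ^+ 2 + y' ^+ 2) * (a ^+ 2 + b' ^+ 2)).
      by rewrite -kE; ring.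
    by rewrite -qx' -qa'.
  have [k0|k0] := eqVneq k 0.
    move/eqP: kE; rewrite k0 mul0r subr_eq0 => /eqP kE.
    have : q * x ^+ 2 = q * a ^+ 2.
      rewrite {1}qa' mulrDl -[b' ^+ 2 * _]exprMn [b' * x]mulrC kE {1}qx'; ring.
    move/(mulfI (lt0r_neq0 q0))/eqP; rewrite eqf_sqr => /orP[/eqP//|/eqP xa].
    by exfalso; rewrite xa in x4; clear -x4 a4; lia.
  have k1 : 1 <= k ^+ 2 by clear -k0; nia.
  have n0 : (x * a + y' * b') ^+ 2 = 0.
    apply/eqP; rewrite eq_le sqr_ge0 andbT; move: norm; rewrite exprMn.
    have : 0 < q ^+ 2 by rewrite exprn_gt0.
    by move: (k ^+ 2) k1 (q ^+ 2) ((x * a + y' * b') ^+ 2) => K k1 Q N;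
      clear -k1; nia.
  have e : x * a = - (y' * b').
    by apply/eqP; rewrite -addr_eq0 -sqrf_eq0 n0.
  have : q * (q - (x ^+ 2 + a ^+ 2)) = 0.
    have h : (x * a) ^+ 2 = (y' * b') ^+ 2 by rewrite e sqrrN.
    have yE : y' ^+ 2 = q - x ^+ 2 by rewrite qx'; ring.
    have bE : b' ^+ 2 = q - a ^+ 2 by rewrite qa'; ring.
    transitivity ((q - x ^+ 2) * (q - a ^+ 2) - (x * a) ^+ 2); first by ring.
    by rewrite h exprMn yE bE subrr.
  move/eqP; rewrite mulf_eq0 (negPf (lt0r_neq0 q0)) /= subr_eq0 => /eqP qxa.
  have [x' xE] : exists x', x = 2 * x' + 1.
    by exists ((x - 1) %/ 2)%Z; clear -x4; lia.
  have [a' aE] : exists a', a = 2 * a' + 1.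
    by exists ((a - 1) %/ 2)%Z; clear -a4; lia.
  by exfalso; move: q_odd qxa; rewrite xE aE; clear; lia.
have coprime_pr z : ~~ (p %| z)%Z -> coprimez (p ^ r)%N%:Z z.
  move=> pz; by rewrite coprimezE /= coprime_pexpl // prime_coprime.
have prod : ((p ^ r)%N%:Z %| (x * b - y * a) * (x * b + y * a))%Z.
  apply/dvdzP; exists (x ^+ 2 - a ^+ 2).
  have yE : y ^+ 2 = (p ^ r)%N%:Z - x ^+ 2 by rewrite qx; ring.
  have bE : b ^+ 2 = (p ^ r)%N%:Z - a ^+ 2 by rewrite qa; ring.
  transitivity (x ^+ 2 * b ^+ 2 - y ^+ 2 * a ^+ 2); first by ring.
  by rewrite yE bE; ring.
have [pd|pd] := boolP (p %| x * b - y * a)%Z; last first.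
  rewrite Gauss_dvdzr ?coprime_pr // in prod.
  by apply: (core (- y) b) => //; rewrite ?sqrrN // mulNr opprK.
have ps : ~~ (p %| x * b + y * a)%Z.
  apply/negP => ps.
  have : (p %| 2 * (x * b))%Z.
    have -> : 2 * (x * b) = (x * b - y * a) + (x * b + y * a) by ring.
    by rewrite rpredD.
  rewrite dvdzE !abszM !absz_nat !Euclid_dvdM // => /or3P[p2|px'|pb].
  - by move: p2 p_odd; rewrite dvdn_prime2 // => /eqP->.
  - by case/negP: px.
  case/negP: pa; have : (p %| a ^+ 2)%Z.
    have -> : a ^+ 2 = (p ^ r)%N%:Z - b ^+ 2 by rewrite qa; ring.
    by rewrite rpredB // dvdzE ?abszX ?absz_nat dvdn_exp.
  by rewrite !dvdzE expr2 abszM Euclid_dvdM // orbb.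
rewrite Gauss_dvdzl ?coprime_pr // in prod.
exact: core prod.
Qed.

(** * The Jacobi sum as a Gaussian integer *)

(** Real and imaginary parts of the powers of a square root of -1. *)
Definition gauss_re (k : nat) : int :=
  match (k %% 4)%N with 0%N => 1 | 2%N => - 1 | _ => 0 end.
Definition gauss_im (k : nat) : int :=
  match (k %% 4)%N with 1%N => 1 | 3%N => - 1 | _ => 0 end.

Lemma gauss_cases k : [\/ gauss_re k = 1 /\ gauss_im k = 0,
  gauss_re k = 0 /\ gauss_im k = 1, gauss_re k = - 1 /\ gauss_im k = 0
  | gauss_re k = 0 /\ gauss_im k = - 1].
Proof.
rewrite /gauss_re /gauss_im; have := ltn_pmod k (isT : (0 < 4)%N).
case: (k %% 4)%N => [|[|[|[|]]]] // _;
  by [constructor 1|constructor 2|constructor 3|constructor 4].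
Qed.

(* Below, [j] is either [chi g], a complex number, or a power of [g] in [F]. *)
Section GaussianPowers.
Variables (R : comNzRingType) (j : R).
Hypothesis j2 : j ^+ 2 = - 1.

Lemma gauss_pow k : j ^+ k = (gauss_re k)%:~R + (gauss_im k)%:~R * j.
Proof.
have j4 : j ^+ 4 = 1 by rewrite (exprM _ 2 2) j2 sqrrN expr1n.
rewrite {1}(divn_eq k 4) exprD mulnC exprM j4 expr1n mul1r.
rewrite /gauss_re /gauss_im; have := ltn_pmod k (isT : (0 < 4)%N).
have j3 : j ^+ 3 = - j by rewrite exprS j2 mulrN1.
by case: (k %% 4)%N => [|[|[|[|]]]] // _; rewrite ?j2 ?j3 /=; ring.
Qed.

Lemma gauss_pow2 k :
  j ^+ k ^+ 2 = (gauss_re k ^+ 2 - gauss_im k ^+ 2)%:~R.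
Proof.
have h : gauss_re k * gauss_im k = 0.
  by have [] := gauss_cases k => -[-> ->]; rewrite ?(mulr0, mul0r).
rewrite gauss_pow sqrrD exprMn j2 mulrA -intrM h mul0r mul0rn addr0.
by rewrite mulrN1 intrB -!rmorphXn.
Qed.

Lemma gauss_pow3 k : j ^+ k ^+ 3 = (gauss_re k)%:~R - (gauss_im k)%:~R * j.
Proof.
rewrite exprSr gauss_pow2 gauss_pow.
have [] := gauss_cases k => -[-> ->]; ring.
Qed.
End GaussianPowers.

(** Power sums over a finite field. *)
Lemma sum_expr_finField (F : finFieldType) k : (0 < k < #|F|.-1)%N ->
  \sum_(a : F) a ^+ k = 0.
Proof.
case/andP=> k0 kq.
have [b b0 bk] : exists2 b : F, b != 0 & b ^+ k != 1.
  apply/exists_inP; apply: contraLR kq; rewrite negb_exists_in => /forall_inP h.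
  rewrite -leqNgt -(cardC1 (0 : F)) cardE; apply: max_unity_roots => //.
    apply/allP => b; rewrite mem_enum => /h; rewrite negbK.
    by rewrite unity_rootE.
  exact: enum_uniq.
have h : b ^+ k * (\sum_(a : F) a ^+ k) = \sum_(a : F) a ^+ k.
  rewrite mulr_sumr -[RHS](sum_scale _ b0); apply: eq_bigr => a _.
  by rewrite exprMn.
move/eqP: h; rewrite -subr_eq0 -[X in _ - X]mul1r -mulrBl mulf_eq0 subr_eq0.
by rewrite (negPf bk) => /eqP.
Qed.

(** Here [a] is odd, [b] is even and, by the residue of [n] modulo 8, [b / 2] is
    odd. *)
Lemma sum2_mod4 (a b n : int) : n = a ^+ 2 + b ^+ 2 -> (n = 5 %[mod 8])%Z ->
  (4 %| a - b + n)%Z -> (2 %| b)%Z -> (a = 1 %[mod 4])%Z.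
Proof.
move=> nE n8 /dvdzP[k kE] /dvdzP[b' bE].
have [c [aE|aE]] : exists c, a = 2 * c \/ a = 2 * c + 1.
  by exists (a %/ 2)%Z; lia.
  exfalso; have : n = 4 * (c ^+ 2 + b' ^+ 2) by rewrite nE aE bE; ring.
  by lia.
have [d dE] : exists d, c ^+ 2 + c = 2 * d.
  exists ((c ^+ 2 + c) %/ 2)%Z.
  have [e [->|->]] : exists e, c = 2 * e \/ c = 2 * e + 1.
    by exists (c %/ 2)%Z; lia.
  - by rewrite (_ : (2 * e) ^+ 2 + 2 * e = 2 * (2 * e ^+ 2 + e)); [lia|ring].
  - rewrite (_ : (2 * e + 1) ^+ 2 + (2 * e + 1)
      = 2 * (2 * e ^+ 2 + 3 * e + 1)); [lia|ring].
have {}nE : n = 8 * d + 1 + 4 * b' ^+ 2.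
  transitivity (4 * (2 * d) + 1 + 4 * b' ^+ 2); last by ring.
  by rewrite -dE nE aE bE; ring.
have [e [b'E|b'E]] : exists e, b' = 2 * e \/ b' = 2 * e + 1.
  by exists (b' %/ 2)%Z; lia.
  exfalso; have : n = 8 * (d + 2 * e ^+ 2) + 1 by rewrite nE b'E; ring.
  by lia.
by rewrite bE b'E in kE; lia.
Qed.

Section GaussianJacobiSum.
Variables (F : finFieldType) (chi : F -> algC) (g : F).
Hypothesis chiP : odd_quartic_character chi g.
Variables (p r m : nat).
Hypotheses (pp : prime p) (oF : #|F| = (p ^ r)%N) (q8 : #|F| = 5 %[mod 8]).
Hypothesis qE : #|F| = (4 * m + 1)%N.

Local Notation q := (#|F|%:R : algC).
Local Notation X := (chipow chi).
Local Notation jac := (jac chi).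
Local Notation i := (chi g).

Lemma m_odd : odd m. Proof. by move: q8; rewrite qE; lia. Qed.

Lemma m_gt0 : (0 < m)%N. Proof. by have := m_odd; case: m. Qed.

Lemma pchar_F : p \in [pchar F]. Proof. exact: card_finPcharP oF pp. Qed.

Lemma natr_card_F : #|F|%:R = 0 :> F.
Proof.
apply/eqP; rewrite -(dvdn_pcharf pchar_F) oF dvdn_exp //.
by move: oF; rewrite qE; case: r => //; have := m_gt0; lia.
Qed.

Lemma sum_pow_1Bpow n k : \sum_(a : F) a ^+ n * (1 - a) ^+ k
  = \sum_(l < k.+1) ((-1) ^+ l *+ 'C(k, l)) * \sum_(a : F) a ^+ (n + l).
Proof.
under eq_bigr do rewrite exprBn mulr_sumr.
rewrite exchange_big /=; apply: eq_bigr => l _; rewrite mulr_sumr.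
by apply: eq_bigr => a _; rewrite expr1n mulr1 exprD -mulrnAl mulrCA.
Qed.

(** In [F] the character [chi] becomes [a |-> a ^ m] or [a |-> a ^ (3 m)]
    according to the choice of a square root of -1 in [F]; the Jacobi sum
    vanishes for the first choice and not for the second. *)
Lemma sum_pow_m : \sum_(a : F) a ^+ m * (1 - a) ^+ (2 * m) = 0.
Proof.
rewrite sum_pow_1Bpow big1 // => l _.
rewrite sum_expr_finField ?mulr0 // qE addn1 /=.
by have := m_gt0; have := ltn_ord l; lia.
Qed.

Lemma sum_pow_3m : \sum_(a : F) a ^+ (3 * m) * (1 - a) ^+ (2 * m) != 0.
Proof.
have m0 := m_gt0; have hm : (m < (2 * m).+1)%N by lia.
rewrite sum_pow_1Bpow (bigD1 (Ordinal hm)) //= [X in _ + X]big1 => [|l lm].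
  rewrite addr0 mulf_neq0 //.
    rewrite -mulr_natr mulf_neq0 ?signr_eq0 // -(dvdn_pcharf pchar_F).
    by apply: (@prime_ndvd_central_bin p r) => //; rewrite -oF.
  rewrite (eq_bigr (fun a : F => (a != 0)%:R)) => [|a _].
    have -> : \sum_(a : F) (a != 0)%:R = (#|F|.-1)%:R :> F.
      by rewrite -natr_sum -big_mkcond sum1_card (cardC1 (0 : F)).
    have /eqP := natr_card_F; rewrite qE addn1 /= -natr1 addr_eq0 => /eqP->.
    by rewrite oppr_eq0 oner_eq0.
  have [->|a0] := eqVneq a 0; first by rewrite expr0n; case: eqP => //; lia.
  apply: (mulIf a0); rewrite mul1r -exprSr (_ : (3 * m + m).+1 = #|F|).
    exact: expf_card.
  by rewrite qE; lia.
have {}lm : (l != m :> nat)%N by [].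
have := ltn_ord l; rewrite ltnS => l2m.
have [lt_lm|lt_ml|e] := ltngtP l m; last by rewrite e eqxx in lm.
  by rewrite sum_expr_finField ?mulr0 // qE addn1 /=; lia.
rewrite (eq_bigr (fun a : F => a ^+ (l - m))) => [|a _].
  by rewrite sum_expr_finField ?mulr0 // qE addn1 /=; lia.
have -> : (3 * m + l = (l - m).-1 + #|F|)%N by rewrite qE; lia.
by rewrite exprD expf_card -exprSr prednK // subn_gt0.
Qed.

(** The real part [A] of [jac 1 2], characterized among the representations of
    [#|F|] as a sum of two squares. *)
Lemma gaussian_jac : exists A B : int,
  [/\ jac 1 2 = A%:~R + B%:~R * i, jac 3 2 = A%:~R - B%:~R * i,
      #|F|%:Z = A ^+ 2 + B ^+ 2, ~~ (p %| A)%Z & (A = 1 %[mod 4])%Z].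
Proof.
have [dlog dlogP] : exists dlog : F -> nat, forall a, a != 0 -> a = g ^+ dlog a.
  apply: (fin_all_exists (P := fun a k => a != 0 -> a = g ^+ k)) => a.
  have [->|/(oqc_gen chiP)[k ->]] := eqVneq a 0; first by exists 0%N.
  by exists k.
(* [zr a + zi a * i] is the value of [chi] at [a], and [zs a] that of its
   square; [dlog 0] is arbitrary, hence the factor [n]. *)
pose n (a : F) : int := (a != 0)%:R.
pose zr a := n a * gauss_re (dlog a); pose zi a := n a * gauss_im (dlog a).
pose zs a := zr a ^+ 2 - zi a ^+ 2.
have i2 : i ^+ 2 = - 1 := oqc_sqr_gen chiP.
have n0 : n 0 = 0 by rewrite /n eqxx.
have nP a : a != 0 -> n a = 1 by rewrite /n => ->.
have zr0 : zr 0 = 0 by rewrite /zr n0 mul0r.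
have zi0 : zi 0 = 0 by rewrite /zi n0 mul0r.
have zs0 : zs 0 = 0 by rewrite /zs zr0 zi0 subr0.
have X1 a : X 1 a = (zr a)%:~R + (zi a)%:~R * i.
  have [->|a0] := eqVneq a 0; first by rewrite chipow0 /zr /zi n0 !mul0r addr0.
  rewrite chipow_neq0 // {1}(dlogP a a0) (chiX chiP) expr1 gauss_pow //.
  by rewrite /zr /zi nP // !mul1r.
have X3 a : X 3 a = (zr a)%:~R - (zi a)%:~R * i.
  have [->|a0] := eqVneq a 0; first by rewrite chipow0 /zr /zi n0 !mul0r subr0.
  rewrite chipow_neq0 // {1}(dlogP a a0) (chiX chiP) gauss_pow3 //.
  by rewrite /zr /zi nP // !mul1r.
have X2 a : X 2 a = (zs a)%:~R.
  have [->|a0] := eqVneq a 0; first by rewrite chipow0 zs0.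
  rewrite chipow_neq0 // {1}(dlogP a a0) (chiX chiP) gauss_pow2 //.
  by rewrite /zs /zr /zi nP // !mul1r.
(* [i] is not rational. *)
have indep (a b : int) : a%:~R + b%:~R * i = 0 :> algC -> a = 0 /\ b = 0.
  move=> /eqP; rewrite addr_eq0 => /eqP e.
  have : (a ^+ 2 + b ^+ 2)%:~R = 0 :> algC.
    by rewrite intrD !rmorphXn /= e sqrrN exprMn i2 mulrN1 addNr.
  move/eqP; rewrite intr_eq0 => /eqP; nia.
pose A := \sum_a zr a * zs (1 - a); pose B := \sum_a zi a * zs (1 - a).
have J12 : jac 1 2 = A%:~R + B%:~R * i.
  rewrite /A /B !rmorph_sum /= mulr_suml -big_split /=; apply: eq_bigr => a _.
  by rewrite X1 X2 !intrM; ring.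
have J32 : jac 3 2 = A%:~R - B%:~R * i.
  rewrite /A /B !rmorph_sum /= mulr_suml -sumrB; apply: eq_bigr => a _.
  by rewrite X3 X2 !intrM; ring.
have normE : #|F|%:Z = A ^+ 2 + B ^+ 2.
  apply/eqP; rewrite -(eqr_int algC) -[_%:~R]/q -(jac_norm chiP) J12 J32.
  rewrite intrD !rmorphXn /=; apply/eqP.
  transitivity (A%:~R ^+ 2 - B%:~R ^+ 2 * i ^+ 2 : algC); first by ring.
  by rewrite i2; ring.
exists A, B; split=> //.
- have m0 := m_gt0.
  (* The same integers give [a ^+ m], for the square root of -1 [g ^+ m]. *)
  have j2 : g ^+ m ^+ 2 = - 1.
    have /eqP : g ^+ m ^+ 2 ^+ 2 = 1.
      apply: (mulIf (gen_neq0 chiP)); rewrite mul1r -!exprM -exprSr.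
      by rewrite (_ : (m * (2 * 2)).+1 = #|F|) ?expf_card // qE; lia.
    rewrite sqrf_eq1 => /orP[/eqP h|/eqP//]; exfalso.
    have := congr1 chi h; rewrite -exprM mulnC (chiX chiP) exprM i2 (chi1 chiP).
    by rewrite -signr_odd m_odd expr1 => /eqP; rewrite (negPf algC_N1_neq1).
  have P1 (a : F) : a ^+ m = (zr a)%:~R + (zi a)%:~R * g ^+ m.
    have [->|a0] := eqVneq a 0.
      by rewrite expr0n (gtn_eqF m0) zr0 zi0 mul0r addr0.
    by rewrite {1}(dlogP a a0) exprAC (gauss_pow j2) /zr /zi nP // !mul1r.
  have P3 (a : F) : a ^+ (3 * m) = (zr a)%:~R - (zi a)%:~R * g ^+ m.
    have [->|a0] := eqVneq a 0.
      by rewrite expr0n muln_eq0 (gtn_eqF m0) /zr /zi n0 !mul0r subr0.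
    rewrite {1}(dlogP a a0) mulnC exprM [g ^+ _ ^+ m]exprAC (gauss_pow3 j2).
    by rewrite /zr /zi nP // !mul1r.
  have P2 (a : F) : a ^+ (2 * m) = (zs a)%:~R.
    have [->|a0] := eqVneq a 0.
      by rewrite expr0n muln_eq0 (gtn_eqF m0) /zs /zr /zi n0 !mul0r subr0.
    rewrite {1}(dlogP a a0) mulnC exprM [g ^+ _ ^+ m]exprAC (gauss_pow2 j2).
    by rewrite /zs /zr /zi nP // !mul1r.
  have S1 : A%:~R + B%:~R * g ^+ m = 0 :> F.
    rewrite -sum_pow_m /A /B !rmorph_sum /= mulr_suml -big_split /=.
    by apply: eq_bigr => a _; rewrite (P1 a) P2 !intrM; ring.
  have S3 : A%:~R - B%:~R * g ^+ m != 0 :> F.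
    apply/eqP => S3; case/negP: sum_pow_3m; apply/eqP; rewrite -[RHS]S3.
    rewrite /A /B !rmorph_sum /= mulr_suml -sumrB /=.
    by apply: eq_bigr => a _; rewrite (P3 a) P2 !intrM; ring.
  apply/negP => /dvdzP[k Ak]; move: S1 S3.
  have -> : A%:~R = 0 :> F.
    by rewrite Ak intrM -pmulrn (pcharf0 pchar_F) mulr0.
  by rewrite add0r => ->; rewrite subrr eqxx.
have zs1 : zs 1 = 1.
  by apply/eqP; rewrite -(eqr_int algC) -X2 (chipow1 chiP).
have [zr1 zi1] : zr 1 = 1 /\ zi 1 = 0.
  have [] := indep (zr 1 - 1) (zi 1).
    by rewrite intrB addrAC -X1 (chipow1 chiP) subrr.
  by move/eqP; rewrite subr_eq0 => /eqP.
have [Szr Szi] : \sum_a zr a = 0 /\ \sum_a zi a = 0.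
  apply: indep; rewrite !rmorph_sum /= mulr_suml -big_split /=.
  by under eq_bigr do rewrite -X1; rewrite (sum_chipow chiP).
have Szs : \sum_a zs a = 0.
  apply/eqP; rewrite -(eqr_int algC) rmorph_sum /=.
  by under eq_bigr do rewrite -X2; rewrite (sum_chipow chiP).
have sumn (f : F -> int) : \sum_a f a * n (1 - a) = \sum_a f a - f 1.
  rewrite [in RHS](bigD1 (1 : F)) //= addrC addrK.
  rewrite (bigD1 (1 : F)) //= subrr n0 mulr0 add0r; apply: eq_bigr => a a1.
  by rewrite nP ?mulr1 // subr_eq0 eq_sym.
have sumn' (f : F -> int) : \sum_a n a * f (1 - a) = \sum_a f a - f 1.
  rewrite -sumn -sum_rev; apply: eq_bigr => a _.
  by rewrite mulrC opprB addrC subrK.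
have Sn : \sum_a n a = #|F|%:Z - 1.
  apply/eqP; rewrite -(eqr_int algC) rmorph_sum /= intrB -sum_neq0_indicator.
  by apply/eqP/eq_bigr => a _; rewrite rmorph_nat.
have n1 : n 1 = 1 by rewrite nP ?oner_eq0.
(* The next two sums have their terms in [{0, 4}] and in [{-2, 0, 2}]. *)
have D4 : (4 %| A - B + #|F|%:Z)%Z.
  have -> : A - B + #|F|%:Z
      = \sum_a (zr a - zi a - n a) * (zs (1 - a) - n (1 - a)).
    transitivity (A - B - \sum_a (zr a - zi a) * n (1 - a)
        - \sum_a n a * zs (1 - a) + \sum_a n a * n (1 - a)).
      rewrite !sumn sumn' sumrB Szr Szi Szs zs1 zr1 zi1 Sn n1; ring.
    rewrite /A /B -!sumrB -big_split /=; apply: eq_bigr => a _; ring.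
  apply: rpred_sum => a _.
  have [->|a0] := eqVneq a 0.
    by rewrite zr0 zi0 n0 !subr0 mul0r.
  have [->|a1] := eqVneq (1 - a) 0.
    by rewrite zs0 n0 subr0 mulr0.
  rewrite /zs /zr /zi !nP // !mul1r.
  by have [] := gauss_cases (dlog a) => -[-> ->];
    have [] := gauss_cases (dlog (1 - a)) => -[-> ->].
have B2 : (2 %| B)%Z.
  have -> : B = \sum_a zi a * (zs (1 - a) - n (1 - a)).
    transitivity (B - \sum_a zi a * n (1 - a)).
      by rewrite sumn Szi zi1 !subr0.
    rewrite /B -sumrB; apply: eq_bigr => a _; ring.
  apply: rpred_sum => a _.
  have [->|a1] := eqVneq (1 - a) 0.
    by rewrite zs0 n0 subr0 mulr0.
  rewrite /zs /zr /zi (nP _ a1) !mul1r dvdz_mull //.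
  by have [] := gauss_cases (dlog (1 - a)) => -[-> ->].
apply: sum2_mod4 normE _ D4 B2; clear -q8; lia.
Qed.
End GaussianJacobiSum.

Theorem corollary2p4 (p r q : nat) (F : finFieldType)
    (phi chi4 : 'CF([set: {unit F}]%G)) (x y : int)
    (hp : prime p) (hq : q = (p ^ r)%N) (hq8 : q = 5 %[mod 8])
    (hF : #|F| = q)
    (hphi : phi \is a linear_char) (hphi2 : #[phi]%CF = 2%N)
    (hchi4 : chi4 \is a linear_char) (hchi44 : #[chi4]%CF = 4%N)
    (hxy : q%:Z = x ^+ 2 + y ^+ 2)
    (hx4 : (x = 1 %[mod 4])%Z) (hpx : ~~ (p%:Z %| x)%Z) :
  (num_transitive_subtournaments 4 (@fourth_power_digraph F))%:R =
  q%:R * (q%:R - 1) / 2 ^+ 12 *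
    (q%:R ^+ 2 + 2 * q%:R * (5 * x%:~R - 21)
     + 24 * x%:~R ^+ 2 - 150 * x%:~R + 241
     + 10 * q%:R ^+ 2 * greene_3F2 chi4 phi phi 1 1 1) :> algC.
Proof.
have q8 : #|F| = 5 %[mod 8] by rewrite hF.
have [g chiP phiE] := odd_quartic_chval q8 hphi hphi2 hchi4 hchi44.
have qE : #|F| = (4 * (#|F| %/ 4) + 1)%N by clear -q8; lia.
have oF : #|F| = (p ^ r)%N by rewrite hF.
have r0 : (0 < r)%N.
  by case: r hq {oF} => // hq; move: hq8; rewrite hq expn0.
have p_odd : odd p.
  have : odd (p ^ r) by rewrite -hq; clear -hq8; lia.
  by rewrite oddX (gtn_eqF r0).
have [A [B [J12 J32 normE pA A4]]] := gaussian_jac chiP hp oF q8 qE.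
have xA : x = A.
  by apply: (prime_power_sum2_unique hp p_odd r0 _ _ hpx pA hx4 A4);
    [rewrite -hq; exact: hxy | rewrite -oF; exact: normE].
have sumJ : jac (chval chi4) 1 2 + jac (chval chi4) 3 2 = 2 * x%:~R.
  by rewrite J12 J32 xA; ring.
have := greene_3F2_conf_sum chiP phiE hphi hchi4.
have := count_fourth_pairs chiP.
rewrite (num_transitive_subtournaments4 chiP) sumJ hF.
move: (\sum_c _) (conf_sum _ _) (greene_3F2 _ _ _ _ _ _) => N t G hN hG.
have n4 : 4 ^+ 5 != 0 :> algC by rewrite expf_neq0 // pnatr_eq0.
have -> : N = 4 ^- 5 * (4 ^+ 5 * N) by rewrite mulKf.
rewrite hN -[t]opprK -hG.
move: (q%:R : algC) (x%:~R : algC) => Q X.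
by field.
Qed.
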